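(* The inequality $\mathrm{ET}_{1,s}(4)$ is satisfied, and the constant $4$ is optimal. That is: for all symmetric log-concave probability measures $\eta_1,\eta_2$ on $\mathbb{R}$ having essentially continuous densities, with moment measures $\nu_1,\nu_2$, \[ H(\eta_1)+H(\eta_2)\le -\log(4e^2)+\mathcal{T}(\nu_1,\nu_2), \] and for every $c>4$ the corresponding inequality with $4$ replaced by $c$ fails for some such pair $\eta_1,\eta_2$.
   Context: A probability measure $\eta$ on $\mathbb{R}$ is log-concave if it has a density with respect to Lebesgue measure of the form $e^{-V}$, where $V:\mathbb{R}\to\mathbb{R}\cup\{+\infty\}$ is convex and lower semicontinuous; $V$ is called the potential of $\eta$. It has an essentially continuous density if $e^{-V(x)}=0$ at every point $x$ of the boundary of the support of $\eta$. It is symmetric if $\eta(A)=\eta(-A)$ for all Borel sets $A$. The moment measure of $\eta$ is the pushforward $\nu=V'\#\eta$ of $\eta$ under the ($\eta$-almost everywhere defined) derivative $V'$. Relative entropy: $H(\eta)=\int \log\left(\frac{d\eta}{dx}\right)d\eta$. Let $\mathcal{F}(\mathbb{R})$ be the set of convex lower semicontinuous functions $f:\mathbb{R}\to\mathbb{R}\cup\{+\infty\}$ taking at least one finite value, and $f^*(y)=\sup_{x}\{xy-f(x)\}$ the Fenchel-Legendre transform. For Borel probability measures $\mu_1,\mu_2$ on $\mathbb{R}$ with finite first moment, \[ \mathcal{T}(\mu_1,\mu_2)=\inf_{f\in\mathcal{F}(\mathbb{R})}\left\{\int f\,d\mu_1+\int f^*\,d\mu_2\right\}. \] For $c>0$,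 $\mathrm{ET}_{1,s}(c)$ is the statement: $H(\eta_1)+H(\eta_2)\le-\log(ce^2)+\mathcal{T}(\nu_1,\nu_2)$ for all symmetric log-concave probability measures $\eta_1,\eta_2$ on $\mathbb{R}$ with essentially continuous densities, $\nu_1,\nu_2$ being their moment measures. *)

(* Defs.v *)
From HB Require Import structures.
From mathcomp Require Import all_boot all_order all_algebra.
From mathcomp Require Import all_classical all_reals all_analysis.

Set Implicit Arguments.
Unset Strict Implicit.
Unset Printing Implicit Defensive.

Import Order.TTheory GRing.Theory Num.Theory.
Import numFieldNormedType.Exports.

Local Open Scope classical_set_scope.
Local Open Scope ring_scope.
Local Open Scope ereal_scope.
Local Open Scope charge_scope.

(** Functions [R -> R U {+oo}] are functions [f : R -> \bar R] avoiding [-oo].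
    At the endpoints [t = 0, 1] the convention [0 * +oo = 0] of [\bar R] makes
    the convexity inequality trivial. *)
Definition econvex_function {R : realType} (f : R -> \bar R) : Prop :=
  forall (x y t : R), (0 <= t <= 1)%R ->
    f (t * x + (1 - t) * y)%R <= t%:E * f x + (1 - t)%:E * f y.

Definition convex_lsc {R : realType} (f : R -> \bar R) : Prop :=
  [/\ forall x, f x != -oo, econvex_function f & lower_semicontinuous f].

(** The set F(R). *)
Definition proper_convex_lsc {R : realType} : set (R -> \bar R) :=
  [set f | convex_lsc f /\ exists x, f x \is a fin_num].

Definition legendre {R : realType} (f : R -> \bar R) (y : R) : \bar R :=
  ereal_sup [set (x * y)%:E - f x | x in [set: R]].

(** For [f] in F(R) both [f] and [legendre f] have an affine minorant, so when
    [mu1] and [mu2] have a finite first moment (as moment measures do) neither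
    integral is [-oo] and no [+oo - oo] occurs in this definition. *)
Definition transport_cost {R : realType}
    (mu1 mu2 : probability (measurableTypeR R) R) : \bar R :=
  ereal_inf [set \int[mu1]_x f x + \int[mu2]_y legendre f y
            | f in proper_convex_lsc].

Definition rel_entropy {R : realType}
    (eta : probability (measurableTypeR R) R) : \bar R :=
  \int[eta]_x lne (('d (charge_of_finite_measure eta) '/d lebesgue_measure) x).

(** [eta] is log-concave with potential [V]. *)
Definition log_concave_with {R : realType}
    (eta : probability (measurableTypeR R) R) (V : R -> \bar R) : Prop :=
  convex_lsc V /\
  forall A : set (measurableTypeR R), measurable A ->
    eta A = \int[lebesgue_measure]_(x in A) expeR (- V x).

Definition measure_support {R : realType}
    (eta : probability (measurableTypeR R) R) : set R :=
  [set x | forall U : set R, open U -> U x -> 0 < eta U].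

Definition boundary {T : topologicalType} (A : set T) : set T :=
  closure A `\` interior A.

Definition essentially_continuous {R : realType}
    (eta : probability (measurableTypeR R) R) (V : R -> \bar R) : Prop :=
  forall x, boundary (measure_support eta) x -> expeR (- V x) = 0.

Definition symmetric_measure {R : realType}
    (eta : probability (measurableTypeR R) R) : Prop :=
  forall A : set (measurableTypeR R), measurable A ->
    eta A = eta [set (- x)%R | x in A].

(** [eta]-almost every point lies in the interior of the domain of [V] and is a
    differentiability point of [V]; there [fine \o V] coincides with [V] near
    the point and [derive1 (fine \o V)] is the derivative of [V]. The values taken
    elsewhere do not affect the pushforward. *)
Definition is_moment_measure {R : realType}
    (eta : probability (measurableTypeR R) R) (V : R -> \bar R)
    (nu : probability (measurableTypeR R) R) : Prop :=
  forall A : set (measurableTypeR R), measurable A ->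
    nu A = pushforward eta (derive1 (fine \o V) : R -> measurableTypeR R) A.

Definition ET1s {R : realType} (c : R) : Prop :=
  forall (eta1 eta2 nu1 nu2 : probability (measurableTypeR R) R)
         (V1 V2 : R -> \bar R),
    log_concave_with eta1 V1 -> log_concave_with eta2 V2 ->
    symmetric_measure eta1 -> symmetric_measure eta2 ->
    essentially_continuous eta1 V1 -> essentially_continuous eta2 V2 ->
    is_moment_measure eta1 V1 nu1 -> is_moment_measure eta2 V2 nu2 ->
    rel_entropy eta1 + rel_entropy eta2
      <= (- ln (c * expR 1 ^+ 2))%:E + transport_cost nu1 nu2.

(* Main.v *)
From HB Require Import structures.
Require Import Defs.
From mathcomp Require Import all_boot all_order all_algebra.
From mathcomp Require Import all_classical all_reals all_analysis.
From mathcomp Require Import measurable_realfun.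
From mathcomp Require Import ring lra.

Set Implicit Arguments.
Unset Strict Implicit.
Unset Printing Implicit Defensive.

Import Order.TTheory GRing.Theory Num.Theory.
Import numFieldNormedType.Exports.

Local Open Scope classical_set_scope.
Local Open Scope ring_scope.


(** Let [eta] be symmetric and log-concave with density [f = exp (- V)].  Parametrize
    its positive half by the mass [t] in (0, 1/2) of the tail beyond a point: [q t]
    is the point beyond which the mass is [t], [I t = f (q t)] is the isoperimetric
    profile of [eta] and [u t = V' (q t)].  Since [q] carries Lebesgue measure on
    (0, 1/2) to the positive half of [eta],
    - the entropy of [eta] is twice the integral of [ln I] ([rel_entropy_profile]);
    - the moment measure is the law of [u t] and [- u t] ([moment_sym_law]);
    - [I] is concave with derivative [u], because [f' = - V' f] while the tail has
      derivative [- f]; and [I] tends to 0 at 0, which is exactly where essential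
      continuity is needed ([moment_profile], [density_small]).

    For two measures let [m] be the integral of [u1 u2] over (0, 1/2).  The coupling
    that uses the same [t] and the same sign for both moment measures, together with
    Young's inequality [x y <= f x + f^* y], shows that the transport cost is at
    least [2 m] ([le_transport_cost]).  Both [u1] and [u2] are nonincreasing, so
    Chebyshev's correlation inequality on (0, t) gives
    [I1 t * I2 t <= t * m] ([chebyshev_supergradient]).  Hence the sum of the
    entropies is at most twice the integral of [ln (t m)] over (0, 1/2), that is
    [ln m - 1 - ln 2], and [ln (2 m) <= 2 m - 1] bounds this by
    [- ln 4 - 2 + 2 m] ([profile_inequality]).

    Equality forces [m = 1/2] and [I1 t * I2 t = t * m], as for the Laplace density
    ([I1 t = t]) against the uniform density on [-1, 1] ([I2 t = 1/2]).  The latter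
    is not essentially continuous, so exponential tails of scale [d] are added to
    it: this is [plateau_potential d], which is the Laplace potential for [d = 1].
    Its entropy is at least [- ln 2 - d] ([plateau_entropy_ge]), while the cost is at
    most 1, as one sees by testing with the indicator function of [-1, 1] and its
    conjugate [`|y|].  Letting [d] tend to 0 rules out every constant above 4
    ([ET1s_optimal]). *)

(** * Monotone slopes and their primitives *)
Section Monotone.
Context {R : realType}.
Notation mu := (@lebesgue_measure R).

Lemma monotone_measurable (D : set R) (f : R -> R) : is_interval D ->
  (forall x y, D x -> D y -> x <= y -> f x <= f y) -> measurable_fun D f.
Proof.
move=> iD f_nd.
have mD : measurable D by exact: is_interval_measurable.
apply: (measurability (@RGenCInfty.G R)) => [|/= _ [_] [r] -> <-].
  exact: RGenCInfty.measurableE.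
apply: is_interval_measurable => s t/=.
rewrite !in_itv/= !andbT => -[Ds fs] [Dt ft] w /andP[sw wt].
have Dw : D w by apply: (iD s t) => //; rewrite sw wt.
by split=> //; rewrite in_itv/= andbT (le_trans fs)// f_nd.
Qed.

Lemma antitone_measurable (D : set R) (f : R -> R) : is_interval D ->
  (forall x y, D x -> D y -> x <= y -> f y <= f x) -> measurable_fun D f.
Proof.
move=> iD f_ni.
have mD : measurable D by exact: is_interval_measurable.
rewrite -(opprK f); apply/measurable_funN.
by apply: monotone_measurable => // x y Dx Dy xy; rewrite lerN2 f_ni.
Qed.

(** The slopes [u] lie between the difference quotients of [J]: a concave [J] with a
    choice of supergradients, stated without derivatives so that primitives can be
    computed from monotonicity alone. *)
Definition supergradient (b : R) (J u : R -> R) := forall s t : R,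
  0 < s -> s < t -> t < b -> u t * (t - s) <= J t - J s <= u s * (t - s).

Definition vanishes_at0 (b : R) (J : R -> R) := forall e : R, 0 < e ->
  exists2 d, 0 < d & forall t : R, 0 < t -> t < d -> t < b -> J t <= e.

Lemma supergradient_antitone b J u : supergradient b J u ->
  forall s t : R, 0 < s -> s <= t -> t < b -> u t <= u s.
Proof.
move=> Ju s t s0; rewrite le_eqVlt => /orP[/eqP -> //|st] tb.
have /andP[a1 a2] := Ju s t s0 st tb.
by rewrite -(@ler_pM2r _ (t - s)) ?subr_gt0// (le_trans a1).
Qed.

Lemma supergradient_measurable b J u (D : set R) : supergradient b J u ->
  is_interval D -> (forall x, D x -> 0 < x < b) -> measurable_fun D u.
Proof.
move=> Ju iD Db; apply: antitone_measurable => // x y /Db/andP[x0 xb] /Db/andP[y0 yb] xy.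
exact: (supergradient_antitone Ju).
Qed.

Local Open Scope ereal_scope.

(** Bounds on compact subintervals pass to the whole interval by monotone
    convergence.  The maximum with 0 covers an empty interval. *)
Lemma exhaust_integral_le (b C : R) (g : R -> \bar R) :
  measurable_fun `]0%R, b[ g -> (forall x : R, (0 < x < b)%R -> 0 <= g x) ->
  (forall s t : R, (0 < s)%R -> (s < t)%R -> (t < b)%R -> \int[mu]_(x in `]s, t]) g x <= C%:E) ->
  \int[mu]_(x in `]0%R, b[) g x <= (Num.max 0 C)%:E.
Proof.
move=> mg g0 gC.
have [b0|b0] := leP b 0%R.
  rewrite set_itv_ge ?integral_set0 ?lee_fin ?le_max ?lexx//.
  by rewrite bnd_simp -leNgt.
pose F n : set R := `](b / n.+2%:R)%R, (b - b / n.+2%:R)%R]%classic.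
have bn n : (0 < b / n.+2%:R)%R by rewrite divr_gt0// ltr0n.
have FS n : F n `<=` `]0%R, b[.
  move=> x; rewrite /F/= !in_itv/= => /andP[x1 x2].
  by rewrite (lt_trans (bn n) x1) (le_lt_trans x2)// ltrBlDr ltrDl.
have ndF : nondecreasing_seq F.
  move=> m n mn; apply/subsetPset => x; rewrite /F/= !in_itv/= => /andP[x1 x2].
  have h : (b / n.+2%:R <= b / m.+2%:R)%R.
    by rewrite ler_pM2l// lef_pV2 ?posrE ?ltr0n// ler_nat !ltnS.
  by rewrite (le_lt_trans h x1)/= (le_trans x2)// lerB.
have bigF : \bigcup_n F n = `]0%R, b[%classic.
  apply/seteqP; split => [x [n _] /FS //|x].
  rewrite /= in_itv/= => /andP[x0 xb].
  pose e := Num.min x (b - x)%R.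
  have e0 : (0 < e)%R by rewrite lt_min x0 subr_gt0.
  exists (Num.bound (b / e)%R) => //; rewrite /F/= in_itv/=.
  have h : (b / (Num.bound (b / e)).+2%:R < e)%R.
    rewrite ltr_pdivrMr ?ltr0n// mulrC -ltr_pdivrMr//.
    have := archi_boundP (ltW (divr_gt0 b0 e0)).
    by move=> /lt_le_trans; apply; rewrite ler_nat leqW.
  rewrite (lt_le_trans h) ?ge_min ?lexx//=.
  by rewrite lerBrDl -lerBrDr (le_trans (ltW h))// ge_min lexx orbT.
have := @ge0_nondecreasing_set_cvg_integral _ (measurableTypeR R) R F g [the measure _ _ of mu] ndF.
rewrite bigF => H.
have {}H := H (fun i => measurable_itv _) (fun i => measurable_funS (measurable_itv _) (@FS i) mg)
  (fun i x Fx => g0 x (FS i x Fx)).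
rewrite -(cvg_lim _ H)//; apply: lime_le; first by apply/cvg_ex; eexists; exact: H.
apply: nearW => n /=.
have [h|h] := ltP (b / n.+2%:R)%R (b - b / n.+2%:R)%R.
  apply: (le_trans (gC _ _ (bn n) h _)); first by rewrite ltrBlDr ltrDl.
  by rewrite lee_fin le_max lexx orbT.
rewrite /F set_itv_ge ?integral_set0 ?lee_fin ?le_max ?lexx//.
by rewrite bnd_simp -leNgt.
Qed.


Section primitive.
Variables (b : R) (J u : R -> R).
Hypothesis Ju : supergradient b J u.
Hypothesis u0 : forall x : R, (0 < x < b)%R -> (0 <= u x)%R.

Let sub (s t : R) : (0 < s)%R -> (t < b)%R -> forall x, `]s, t]%classic x -> (0 < x < b)%R.
Proof.
move=> s0 tb x; rewrite /= in_itv/= => /andP[sx xt].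
by rewrite (lt_trans s0 sx) (le_lt_trans xt tb).
Qed.

Let mu_ (s t : R) : (0 < s)%R -> (t < b)%R -> measurable_fun `]s, t] (EFin \o u).
Proof.
move=> s0 tb; apply/measurable_EFinP; apply: (supergradient_measurable Ju).
  exact: interval_is_interval.
exact: sub.
Qed.

(** Fundamental theorem of calculus with an error term.  On one interval both the
    integral and the increment of [J] lie between [u t * (t - s)] and
    [u s * (t - s)]; bisection halves the length, while the oscillations of the
    monotone [u] on the two halves add up, so the total error is halved. *)
Lemma integral_supergradient_error n (s t : R) : (0 < s)%R -> (s < t)%R -> (t < b)%R ->
  (J t - J s - (t - s) * (u s - u t) / 2 ^+ n)%:E <= \int[mu]_(x in `]s, t]) (u x)%:E
    <= (J t - J s + (t - s) * (u s - u t) / 2 ^+ n)%:E.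
Proof.
elim: n s t => [|n IH] s t s0 st tb.
  have st' : (0 < t - s)%R by rewrite subr_gt0.
  have len : mu `]s, t] = (t - s)%:E by rewrite lebesgue_measure_itv/= lte_fin st EFinB.
  have /andP[l1 l2] := Ju s0 st tb.
  apply/andP; split.
    apply: (@le_trans _ _ (\int[mu]_(x in `]s, t]) (u t)%:E)).
      rewrite integral_cst//= len -EFinM lee_fin expr0 divr1; nra.
    apply: ge0_le_integral => //=.
    - by move=> x _; rewrite lee_fin u0// (lt_trans s0 st) tb.
    - exact: mu_.
    - move=> x; rewrite in_itv/= => /andP[sx xt]; rewrite lee_fin.
      by apply: (supergradient_antitone Ju) => //; exact: lt_trans sx.
  apply: (@le_trans _ _ (\int[mu]_(x in `]s, t]) (u s)%:E)).
    apply: ge0_le_integral => //=.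
    - by move=> x xst; rewrite lee_fin u0//; exact: sub xst.
    - exact: mu_.
    - move=> x; rewrite in_itv/= => /andP[sx xt]; rewrite lee_fin.
      by apply: (supergradient_antitone Ju) => //; [exact: ltW|exact: le_lt_trans tb].
  rewrite integral_cst//= len -EFinM lee_fin expr0 divr1; nra.
pose m := ((s + t) / 2)%R.
have sm : (s < m)%R by rewrite /m ltr_pdivlMr//; lra.
have mt : (m < t)%R by rewrite /m ltr_pdivrMr//; lra.
have m0 : (0 < m)%R by exact: lt_trans sm.
have mb : (m < b)%R by exact: lt_trans tb.
have -> : `]s, t]%classic = `]s, m] `|` `]m, t].
  by rewrite -itv_bndbnd_setU// bnd_simp ltW.
rewrite ge0_integral_setU//=.
- have /andP[a1 a2] := IH s m s0 sm mb.
  have /andP[b1 b2] := IH m t m0 mt tb.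
  have e2 : (2 ^+ n != 0 :> R)%R by rewrite expf_neq0// pnatr_eq0.
  have E : ((t - s) * (u s - u t) / 2 ^+ n.+1 =
     (m - s) * (u s - u m) / 2 ^+ n + (t - m) * (u m - u t) / 2 ^+ n)%R.
    by rewrite exprS /m; field.
  apply/andP; split.
    apply: le_trans (leeD a1 b1); rewrite -EFinD lee_fin E; lra.
  apply: le_trans (leeD a2 b2) _; rewrite -EFinD lee_fin E; lra.
- rewrite -itv_bndbnd_setU ?bnd_simp ?ltW//; exact: mu_.
- move=> x xx; rewrite lee_fin u0//.
  by case: xx; [exact: sub|exact: sub].
- apply/disj_setPS => x [] /=; rewrite !in_itv/= => /andP[_ +] /andP[+ _].
  by move=> xm /(le_lt_trans xm); rewrite ltxx.
Qed.

Lemma integral_supergradient (s t : R) : (0 < s)%R -> (s < t)%R -> (t < b)%R ->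
  \int[mu]_(x in `]s, t]) (u x)%:E = (J t - J s)%:E.
Proof.
move=> s0 st tb.
pose K := ((t - s) * (u s - u t))%R.
have K0 : (0 <= K)%R.
  apply: mulr_ge0; rewrite subr_ge0; first exact: ltW.
  by apply: (supergradient_antitone Ju) => //; exact: ltW.
have H n := integral_supergradient_error n s0 st tb.
have fin : \int[mu]_(x in `]s, t]) (u x)%:E \is a fin_num.
  have /andP[h1 h2] := H 0%N; rewrite fin_numElt.
  by rewrite (lt_le_trans _ h1) ?ltNyr// (le_lt_trans h2) ?ltry.
move: H; rewrite -(fineK fin); set x := fine _ => H.
congr EFin; apply/eqP; rewrite -subr_eq0 -normr_le0.
apply/ler_addgt0Pl => e e0.
(* n bisections suffice as soon as n, hence 2 ^ n, exceeds K / e *)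
have [n Kn] : exists n, (K / 2 ^+ n <= e)%R.
  exists (Num.bound (K / e)).
  rewrite ler_pdivrMr ?exprn_gt0// mulrC -ler_pdivrMr//.
  rewrite (le_trans (ltW (archi_boundP _)))//; first by rewrite divr_ge0// ltW.
  by rewrite -natrX ler_nat ltnW// ltn_expl.
have /andP := H n; rewrite !lee_fin -/K => -[h1 h2].
rewrite addr0 (le_trans _ Kn)// ler_norml.
by apply/andP; split; lra.
Qed.

Hypothesis Jge0 : forall x : R, (0 < x < b)%R -> (0 <= J x)%R.

(** The tangent at [t] lies above the graph near 0, where [J] is nonnegative. *)
Lemma mul_supergradient_le (t : R) : (0 < t < b)%R -> (u t * t <= J t)%R.
Proof.
move=> /andP[t0 tb]; apply/ler_addgt0Pl => e e0.
have ut0 : (0 <= u t)%R by rewrite u0// t0.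
pose s := (Num.min (t / 2) (e / (u t + 1)))%R.
have s0 : (0 < s)%R by rewrite lt_min !divr_gt0// ltr_wpDl.
have st : (s < t)%R by rewrite gt_min; apply/orP; left; rewrite ltr_pdivrMr//; lra.
have us : (u t * s <= e)%R.
  apply: (@le_trans _ _ ((u t + 1) * (e / (u t + 1)))%R); last first.
    by rewrite mulrC divfK// gt_eqF// ltr_wpDl.
  apply: ler_pM => //; [exact: ltW|by rewrite lerDl|].
  by rewrite ge_min lexx orbT.
have /andP[+ _] := Ju s0 st tb.
have := Jge0 (x := s); rewrite s0 (lt_trans st tb) => /(_ isT); lra.
Qed.

Hypothesis J0 : vanishes_at0 b J.

Lemma integral_supergradient0 (t : R) : (0 < t < b)%R ->
  \int[mu]_(x in `]0%R, t[) (u x)%:E = (J t)%:E.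
Proof.
move=> /andP[t0 tb].
have sub0 x : `]0%R, t[%classic x -> (0 < x < b)%R.
  by rewrite /= in_itv/= => /andP[-> /lt_trans]; exact.
have mut : measurable_fun `]0%R, t[ (EFin \o u).
  apply/measurable_EFinP; apply: (supergradient_measurable Ju) => //.
  exact: interval_is_interval.
apply/eqP; rewrite eq_le; apply/andP; split.
  rewrite -[J t](_ : Num.max 0 (J t) = J t)%R; last first.
    by apply/max_idPr; rewrite Jge0// t0.
  apply: exhaust_integral_le => //.
    by move=> x xt; rewrite lee_fin u0// sub0//= in_itv.
  move=> s x s0 sx xt; rewrite integral_supergradient//; last exact: lt_trans tb.
  have xb := lt_trans xt tb.
  have := Jge0 (x := s); rewrite s0 (lt_trans sx xb) => /(_ isT) Js.
  have /andP[+ _] := Ju (lt_trans s0 sx) xt tb.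
  have : (0 <= u t * (t - x))%R by rewrite mulr_ge0 ?u0 ?t0 ?subr_ge0 ?ltW.
  by rewrite lee_fin; lra.
apply/lee_addgt0Pr => e e0.
have [d d0 dJ] := J0 e0.
pose s := (Num.min d t / 2)%R.
have mdt : (0 < Num.min d t)%R by rewrite lt_min d0.
have s0 : (0 < s)%R by rewrite divr_gt0.
have sm : (s < Num.min d t)%R by rewrite ltr_pdivrMr//; lra.
have sd : (s < d)%R by rewrite (lt_le_trans sm)// ge_min lexx.
have st : (s < t)%R by rewrite (lt_le_trans sm)// ge_min lexx orbT.
have Js := dJ s s0 sd (lt_trans st tb).
apply: (@le_trans _ _ (\int[mu]_(x in `]s, t]) (u x)%:E + e%:E)).
  by rewrite integral_supergradient// -EFinD lee_fin; lra.
rewrite leeD2r// -integral_itv_bndo_bndc; last first.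
  apply: measurable_funS (mu_ s0 tb) => // x; rewrite /= !in_itv/= => /andP[->].
  exact: ltW.
apply: ge0_subset_integral => //=.
  by move=> x xt; rewrite lee_fin u0// sub0.
by move=> x; rewrite /= !in_itv/= => /andP[/(lt_trans s0) -> ->].
Qed.

End primitive.

End Monotone.

(** * Chebyshev's correlation inequality *)
Section Chebyshev.
Context {R : realType}.
Notation mu := (@lebesgue_measure R).
Local Open Scope ereal_scope.

(** A decreasing slope reaches its mean value: were [u] below [I t / t] throughout,
    the half of the interval next to [t] would lose a definite amount, and the
    increments of [I] could not add up to [I t]. *)
Lemma mean_le_supergradient (b : R) (I u : R -> R) (t : R) : supergradient b I u ->
  (forall x : R, 0 < x < b -> 0 <= I x)%R -> vanishes_at0 b I -> (0 < t < b)%R ->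
  exists2 s, (0 < s < t)%R & (I t / t <= u s)%R.
Proof.
move=> Iu Ige0 I0 /andP[t0 tb]; apply: contrapT => /forall2NP H.
have uA s : (0 < s < t)%R -> (u s < I t / t)%R.
  by move=> st; case: (H s) => [//|/negP]; rewrite -ltNge.
pose s0 := (t / 2)%R.
have s00 : (0 < s0)%R by rewrite divr_gt0.
have s0t : (s0 < t)%R by rewrite /s0; lra.
have h1 : (u s0 < I t / t)%R by apply: uA; rewrite s00.
have /andP[_ h2] := Iu s0 t s00 s0t tb.
have h3 : (I s0 <= I t / t * s0)%R.
  apply/ler_addgt0Pl => e e0.
  have At : (0 <= I t / t)%R by rewrite divr_ge0 ?Ige0 ?t0// ltW.
  have [d d0 dI] := I0 e e0.
  pose s := (Num.min d s0 / 2)%R.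
  have m0 : (0 < Num.min d s0)%R by rewrite lt_min d0.
  have sp : (0 < s)%R by rewrite divr_gt0.
  have sm : (s < Num.min d s0)%R by rewrite /s; lra.
  have sd : (s < d)%R by rewrite (lt_le_trans sm)// ge_min lexx.
  have ss0 : (s < s0)%R by rewrite (lt_le_trans sm)// ge_min lexx orbT.
  have := dI s sp sd (lt_trans ss0 (lt_trans s0t tb)).
  have /andP[_] := Iu s s0 sp ss0 (lt_trans s0t tb).
  have := uA s; rewrite sp (lt_trans ss0 s0t) => /(_ isT); nra.
have : (I t < I t / t * t)%R by nra.
by rewrite divfK ?gt_eqF// ltxx.
Qed.

(** Only single integrals are needed.  With [A] the mean of [u1], pick a threshold
    [v] that separates the values of [u2] where [u1 >= A] from those where
    [u1 < A]; then [(u1 - A) * (u2 - v) >= 0], and integrating this gives the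
    claim because [u1 - A] has integral 0.  The expanded form has nonnegative
    terms only, so an infinite integral of [u1 u2] does no harm. *)
Lemma chebyshev_supergradient (b : R) (I1 u1 I2 u2 : R -> R) (t : R) :
  supergradient b I1 u1 -> supergradient b I2 u2 ->
  (forall x : R, 0 < x < b -> 0 <= u1 x)%R -> (forall x : R, 0 < x < b -> 0 <= u2 x)%R ->
  (forall x : R, 0 < x < b -> 0 <= I1 x)%R -> (forall x : R, 0 < x < b -> 0 <= I2 x)%R ->
  vanishes_at0 b I1 -> vanishes_at0 b I2 -> (0 < t < b)%R ->
  (I1 t * I2 t)%:E <= t%:E * \int[mu]_(x in `]0%R, t[) (u1 x * u2 x)%:E.
Proof.
move=> Iu1 Iu2 u10 u20 I10 I20 v1 v2 tt; have /andP[t0 tb] := tt.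
pose A := (I1 t / t)%R.
have A0 : (0 <= A)%R by rewrite divr_ge0// ?I10// ltW.
have [s1 /andP[s10 s1t] As1] := mean_le_supergradient Iu1 I10 v1 tt.
pose S := [set u2 s | s in [set s | (0 < s < t)%R /\ (A <= u1 s)%R]].
have subb s : (0 < s < t)%R -> (0 < s < b)%R by move=> /andP[-> /lt_trans]; exact.
have S0 : S !=set0 by exists (u2 s1); exists s1 => //; split=> //; rewrite s10 s1t.
have Slb : has_lbound S by exists 0%R => _ [s [st _] <-]; exact/u20/subb.
pose v := inf S.
have v0 : (0 <= v)%R by apply: lb_le_inf => // _ [s [st _] <-]; exact/u20/subb.
have key s : (0 < s < t)%R -> (A * u2 s + v * u1 s <= u1 s * u2 s + A * v)%R.
  move=> st; have [Au|uA] := leP A (u1 s).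
    have vu : (v <= u2 s)%R by apply: ge_inf => //; exists s.
    by nra.
  have uv : (u2 s <= v)%R.
    apply: lb_le_inf => // _ [r [/andP[r0 rt] Ar] <-].
    have /andP[_ sb] := subb _ st; have /andP[_ rb] : (0 < r < b)%R by rewrite subb// r0.
    have [sr|rs] := leP s r; last by apply: (supergradient_antitone Iu2) => //; exact: ltW.
    have /andP[sp _] := st.
    have := supergradient_antitone Iu1 sp sr rb.
    by move=> /(le_trans Ar); rewrite leNgt uA.
  by nra.
pose D : set R := `]0%R, t[%classic.
have Dt x : D x -> (0 < x < t)%R by rewrite /D/= in_itv.
have mU b' I u : supergradient b' I u -> b' = b -> measurable_fun D u.
  move=> Iu ?; subst b'; apply: (supergradient_measurable Iu) => [|x /Dt].
    exact: interval_is_interval.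
  by move=> /subb.
have m1 : measurable_fun D u1 by apply: (mU _ _ _ Iu1).
have m2 : measurable_fun D u2 by apply: (mU _ _ _ Iu2).
have lenD : mu D = t%:E by rewrite /D lebesgue_measure_itv/= lte_fin t0 sube0.
have p1 x : D x -> (0 <= u1 x)%R by move=> /Dt /subb; exact: u10.
have p2 x : D x -> (0 <= u2 x)%R by move=> /Dt /subb; exact: u20.
have E1 : \int[mu]_(x in D) (u1 x)%:E = (I1 t)%:E by apply: (integral_supergradient0 Iu1).
have E2 : \int[mu]_(x in D) (u2 x)%:E = (I2 t)%:E by apply: (integral_supergradient0 Iu2).
have mD : measurable D by exact: measurable_itv.
have : \int[mu]_(x in D) ((A * u2 x)%:E + (v * u1 x)%:E) <=
       \int[mu]_(x in D) ((u1 x * u2 x)%:E + (A * v)%:E).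
  apply: ge0_le_integral => //.
  - by move=> x Dx; rewrite -EFinD lee_fin addr_ge0// mulr_ge0 ?p1 ?p2.
  - by apply/measurable_EFinP; apply: measurable_funD; apply: measurable_funM.
  - by apply/measurable_EFinP; apply: measurable_funD => //; apply: measurable_funM.
rewrite ge0_integralD//=; last 4 first.
- by move=> x Dx; rewrite lee_fin mulr_ge0 ?p2.
- by apply/measurable_EFinP; apply: measurable_funM.
- by move=> x Dx; rewrite lee_fin mulr_ge0 ?p1.
- by apply/measurable_EFinP; apply: measurable_funM.
rewrite ge0_integralD//=; last 3 first.
- by move=> x Dx; rewrite lee_fin mulr_ge0 ?p1 ?p2.
- by apply/measurable_EFinP; apply: measurable_funM.
- by move=> x Dx; rewrite lee_fin mulr_ge0.
under eq_integral do rewrite EFinM.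
under [X in _ + X <= _]eq_integral do rewrite EFinM.
rewrite ge0_integralZl_EFin//; last exact/measurable_EFinP.
rewrite ge0_integralZl_EFin//; last exact/measurable_EFinP.
rewrite E1 E2 integral_cst//= lenD -!EFinM -EFinD.
have : 0 <= \int[mu]_(x in D) (u1 x * u2 x)%:E.
  by apply: integral_ge0 => x Dx; rewrite lee_fin mulr_ge0 ?p1 ?p2.
rewrite -/D; move: (\int[mu]_(x in D) _) => [r| |]; last by [].
  2: by move=> _ _; rewrite gt0_muley ?lte_fin// leey.
move=> _; rewrite -EFinD -EFinM !lee_fin => h.
have AE : (A * t = I1 t)%R by rewrite divfK// gt_eqF.
have h2 : (A * I2 t <= r)%R by nra.
by rewrite -AE; nra.
Qed.

End Chebyshev.

(** * The integral of the logarithm near zero *)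
Section Log.
Context {R : realType}.
Notation mu := (@lebesgue_measure R).

Lemma ln_le_subr1 (x : R) : 0 < x -> ln x <= x - 1.
Proof.
move=> x0; have := @le_ln1Dx R (x - 1); have -> : 1 + (x - 1) = x by ring.
by apply; lra.
Qed.

Lemma supergradient_ln :
  supergradient (1 : R) (fun t => t - t * ln t) (fun t => - ln t).
Proof.
move=> s t s0 st t1; have t0 := lt_trans s0 st.
have h1 := ln_le_subr1 (divr_gt0 t0 s0).
have h2 := ln_le_subr1 (divr_gt0 s0 t0).
move: h1 h2; rewrite !ln_div ?posrE// => h1 h2.
have e1 : s * (t / s - 1) = t - s by field; rewrite gt_eqF.
have e2 : t * (s / t - 1) = s - t by field; rewrite gt_eqF.
by apply/andP; split; nra.
Qed.

Lemma neg_ln_ge0 (x : R) : 0 < x < 1 -> 0 <= - ln x.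
Proof. by move=> /andP[x0 x1]; rewrite oppr_ge0 ln_le0// ltW. Qed.

(** Applying [ln x <= x - 1] to [1 / sqrt t] bounds [- t * ln t] by [2 * sqrt t]. *)
Lemma vanishes_ln : vanishes_at0 (1 : R) (fun t => t - t * ln t).
Proof.
move=> e e0; exists ((e / 2) ^+ 2); first by rewrite exprn_gt0// divr_gt0.
move=> t t0 td t1.
pose r := Num.sqrt t.
have r0 : 0 < r by rewrite sqrtr_gt0.
have tr : t = r * r by rewrite -expr2 sqr_sqrtr// ltW.
have re : r < e / 2.
  by rewrite -(ltr_pXn2r (n := 2)) ?nnegrE ?divr_ge0 ?ltW// expr2 -tr.
have := ln_le_subr1 (x := r^-1); rewrite invr_gt0 => /(_ r0).
rewrite lnV ?posrE// => h.
have h2 : r * (- ln r) <= 1 - r.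
  by have := ler_wpM2l (ltW r0) h; rewrite mulrBr divff ?gt_eqF// mulr1.
rewrite tr lnM ?posrE//; nra.
Qed.

Lemma integral_ln (t : R) : 0 < t < 1 ->
  (\int[mu]_(x in `]0%R, t[) (- ln x)%:E = (t - t * ln t)%:E)%E.
Proof.
apply: (integral_supergradient0 supergradient_ln neg_ln_ge0 _ vanishes_ln).
move=> x /andP[x0 x1]; have := @neg_ln_ge0 x; rewrite x0 x1 => /(_ isT); nra.
Qed.

End Log.

(** * Symmetric laws parametrized by (0, 1/2) *)
Section Measure.
Context d (T : measurableType d) (R : realType) (mu : {measure set T -> \bar R}).
Local Open Scope ereal_scope.

Lemma ge0_integral_mrestr (D : set T) (mD : measurable D) (f : T -> \bar R) :
  measurable_fun setT f -> (forall x, 0 <= f x) ->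
  \int[mrestr mu mD]_x f x = \int[mu]_(x in D) f x.
Proof.
move=> mf f0.
have mDc : measurable (~` D) by exact: measurableC.
rewrite -(setUv D) ge0_integral_setU//=; last 2 first.
- by rewrite setUv.
- by apply/disj_setPS; rewrite setICr.
rewrite [X in _ + X]null_set_integral ?adde0//; last 2 first.
- exact: measurable_funS mf.
- by rewrite /= /mrestr setICl measure0.
apply: eq_measure_integral => A mA AD.
by rewrite /= /mrestr; congr (mu _); apply/setIidPl.
Qed.

Lemma pushforward_measure d' (T' : measurableType d') (f : T -> T') :
  measurable_fun setT f ->
  exists P : {measure set T' -> \bar R}, P = pushforward mu f :> (set T' -> \bar R).
Proof.
move=> mf; unshelve eexists.
  by unshelve refine [the measure _ _ of pushforward mu f]; exact: mf.
by [].
Qed.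

(** The integral of an extended function is a difference of two integrals; with an
    integrable minorant the second one is finite, so the integral behaves as that
    of a nonnegative function. *)
Lemma integrable_or_integral_pinfty (D : set T) (f g : T -> \bar R) :
  measurable D -> measurable_fun D f -> mu.-integrable D g ->
  (forall x, D x -> - g x <= f x) ->
  mu.-integrable D f \/ \int[mu]_(x in D) f x = +oo.
Proof.
move=> mD mf ig gf.
have fneg : \int[mu]_(x in D) f^\- x < +oo.
  case/integrableP : (ig) => mg; apply: le_lt_trans.
  apply: ge0_le_integral => //.
  - exact: measurable_funeneg.
  - exact: measurableT_comp.
  - move=> x Dx; rewrite funenegE ge_max abse_ge0 andbT leeNl.
    by apply: le_trans (gf x Dx); rewrite leeN2 lee_abs.
have fneg0 : 0 <= \int[mu]_(x in D) f^\- x by exact: integral_ge0.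
have [fpos|] := ltP (\int[mu]_(x in D) f^\+ x) +oo.
  left; apply/integrableP; split => //.
  under eq_integral do rewrite -/((abse \o f) _) fune_abse.
  rewrite ge0_integralD//=; [|exact: measurable_funepos|exact: measurable_funeneg].
  exact: lte_add_pinfty.
rewrite leye_eq => /eqP fpos; right.
rewrite integralE fpos.
by move: fneg fneg0; case: (\int[mu]_(x in D) f^\- x).
Qed.

End Measure.

Section Half.
Context {R : realType}.
Notation mu := (@lebesgue_measure R).
Local Open Scope ereal_scope.

(** The range of the tail mass of a symmetric law: the tail has mass 1/2 at 0. *)
Definition half_unit : set R := `]0%R, (2^-1)%R[%classic.

Lemma measurable_half_unit : measurable (half_unit : set (measurableTypeR R)).
Proof. exact: measurable_itv. Qed.

Lemma half_unitP (x : R) : half_unit x = is_true (0 < x < 2^-1)%R.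
Proof. by rewrite /half_unit/= in_itv. Qed.

Lemma half_unit_length : mu half_unit = (2^-1)%:E.
Proof. by rewrite /half_unit lebesgue_measure_itv/= lte_fin invr_gt0 ltr0n sube0. Qed.

(** The law of [e * u t] for a uniform point [t] of (0, 1/2) and a fair sign [e]:
    each sign has probability 1/2, hence weight 1 against Lebesgue measure on
    (0, 1/2). *)
Definition sym_law (P : set R -> \bar R) (u : R -> R) :=
  forall A : set (measurableTypeR R), measurable A ->
    P A = mu (half_unit `&` u @^-1` A) + mu (half_unit `&` (fun t => - u t)%R @^-1` A).

Section sym_law.
Variables (P : {measure set (measurableTypeR R) -> \bar R}) (u : R -> R).
Hypothesis mu_ : measurable_fun half_unit u.
Hypothesis Pu : sym_law P u.

Lemma ge0_integral_sym_law (f : measurableTypeR R -> \bar R) :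
  measurable_fun setT f -> (forall x, 0 <= f x) ->
  \int[P]_x f x = \int[mu]_(t in half_unit) f (u t) + \int[mu]_(t in half_unit) f (- u t)%R.
Proof.
move=> mf f0.
pose up : measurableTypeR R -> measurableTypeR R := u \_ half_unit.
pose un : measurableTypeR R -> measurableTypeR R := (fun t => - u t)%R \_ half_unit.
have mup : measurable_fun setT up.
  exact/(measurable_restrictT _ measurable_half_unit).
have mun : measurable_fun setT un.
  apply/(measurable_restrictT _ measurable_half_unit).
  exact/measurable_funN.
pose m : {measure set (measurableTypeR R) -> \bar R} := mrestr mu measurable_half_unit.
have [Pp PpE] := pushforward_measure m mup.
have [Pn PnE] := pushforward_measure m mun.
have -> : \int[P]_x f x = \int[measure_add Pp Pn]_x f x.
  apply: eq_measure_integral => A mA _.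
  rewrite (Pu mA) [RHS](measure_addE Pp Pn A) PpE PnE /pushforward /m /= /mrestr.
  have upE t : half_unit t -> up t = u t by move=> /mem_set ht; rewrite /up patchE ht.
  have unE t : half_unit t -> un t = (- u t)%R by move=> /mem_set ht; rewrite /un patchE ht.
  congr (mu _ + mu _); apply/seteqP; split => t /=.
  - by move=> [ht At]; rewrite upE.
  - by move=> [At ht]; move: At; rewrite upE.
  - by move=> [ht At]; rewrite unE.
  - by move=> [At ht]; move: At; rewrite unE.
rewrite ge0_integral_measure_add// PpE PnE.
rewrite !ge0_integral_pushforward// ?preimage_setT.
rewrite !ge0_integral_mrestr; [|exact: measurableT_comp|by move=> ?; exact: f0|
  exact: measurableT_comp|by move=> ?; exact: f0].
by congr (_ + _); apply: eq_integral => t th /=; rewrite /up /un patchE th.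
Qed.

(** Integrability splits the positive and negative parts into finite quantities,
    which may be rearranged. *)
Lemma integral_sym_law (f : measurableTypeR R -> \bar R) : measurable_fun setT f ->
  P.-integrable setT f ->
  [/\ mu.-integrable half_unit (fun t => f (u t)),
      mu.-integrable half_unit (fun t => f (- u t)%R) &
      \int[P]_x f x = \int[mu]_(t in half_unit) f (u t) + \int[mu]_(t in half_unit) f (- u t)%R].
Proof.
move=> mf If.
have mfp : measurable_fun half_unit (f \o u).
  exact: measurableT_comp.
have mfn : measurable_fun half_unit (f \o (fun t => - u t)%R).
  by apply: measurableT_comp => //; exact/measurable_funN.
have [fp fn] : \int[mu]_(t in half_unit) `|f (u t)| < +oo /\
    \int[mu]_(t in half_unit) `|f (- u t)%R| < +oo.
  case/integrableP : If => _.
  rewrite ge0_integral_sym_law//; last exact: measurableT_comp.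
  have p1 : 0 <= \int[mu]_(t in half_unit) `|f (u t)| by exact: integral_ge0.
  have p2 : 0 <= \int[mu]_(t in half_unit) `|f (- u t)%R| by exact: integral_ge0.
  move=> h; split; apply: le_lt_trans h; [exact: leeDl|exact: leeDr].
have i1 : mu.-integrable half_unit (fun t => f (u t)) by apply/integrableP.
have i2 : mu.-integrable half_unit (fun t => f (- u t)%R) by apply/integrableP.
split=> //.
rewrite integralE ge0_integral_sym_law//; last exact: measurable_funepos.
rewrite ge0_integral_sym_law//; last exact: measurable_funeneg.
have split_int (g : R -> R) : mu.-integrable half_unit (f \o g) ->
  [/\ \int[mu]_(t in half_unit) f^\+ (g t) \is a fin_num,
      \int[mu]_(t in half_unit) f^\- (g t) \is a fin_num &
      \int[mu]_(t in half_unit) f (g t) =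
        \int[mu]_(t in half_unit) f^\+ (g t) - \int[mu]_(t in half_unit) f^\- (g t)].
  move=> ig.
  have := integrable_pos_fin_num measurable_half_unit ig.
  have := integrable_neg_fin_num measurable_half_unit ig.
  have := integralE mu half_unit (f \o g).
  by rewrite funeneg_comp funepos_comp.
have [a1 a2 ->] := split_int u i1.
have [b1 b2 ->] := split_int (fun t => - u t)%R i2.
by rewrite fin_num_oppeD// addeACA.
Qed.

End sym_law.

End Half.

(** * Weak Kantorovich duality *)
Section Duality.
Context {R : realType}.
Notation mu := (@lebesgue_measure R).
Implicit Types f : R -> \bar R.
Local Open Scope ereal_scope.

(** By lower semicontinuity [f] is above [f x0 - 1] within some distance [d] of a
    point [x0] of its domain; comparing a far point with the point at distance [d]
    of [x0] on the same side, convexity prevents [f] from decreasing faster than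
    with slope [1 / d]. *)
Lemma affine_minorant f : proper_convex_lsc f ->
  exists C : R, forall x, - (C + C * `|x|)%:E <= f x.
Proof.
move=> [[fNy fconv flsc] [x0 fx0]].
move: (fx0); rewrite fin_numE => /andP[_ _].
pose r := fine (f x0); have fr : f x0 = r%:E by rewrite fineK.
have [W W0 fW] : exists2 W, nbhs x0 W & forall y, W y -> (r - 1)%:E < f y.
  by apply: flsc; rewrite fr lte_fin; lra.
have [d0 /= d00 dW] := (@nbhs_ballP R R^o x0 W).1 W0.
pose d := (d0 / 2)%R.
have d_gt0 : (0 < d)%R by rewrite divr_gt0.
have near_ge (y : R) : (`|y - x0| <= d)%R -> (r - 1)%:E < f y.
  move=> yd; apply/fW/dW; rewrite /ball/= distrC (le_lt_trans yd)//.
  by rewrite /d ltr_pdivrMr//; lra.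
have main (x : R) : (r - 1 - `|x - x0| / d)%:E <= f x.
  have [xd|dx] := leP `|x - x0|%R d.
    apply: le_trans (ltW (near_ge _ xd)); rewrite lee_fin.
    have : (0 <= `|x - x0| / d)%R by rewrite divr_ge0// ltW.
    by lra.
  have x0_gt0 : (0 < `|x - x0|)%R by exact: lt_trans d_gt0 dx.
  pose t := (d / `|x - x0|)%R.
  have t0 : (0 < t)%R by rewrite divr_gt0.
  have t1 : (t < 1)%R by rewrite ltr_pdivrMr// mul1r.
  have t01 : (0 <= t <= 1)%R by rewrite !ltW.
  have := fconv x x0 t t01.
  have /near_ge h : (`|t * x + (1 - t) * x0 - x0| <= d)%R.
    have -> : (t * x + (1 - t) * x0 - x0 = t * (x - x0))%R by ring.
    by rewrite normrM (gtr0_norm t0) divfK// gt_eqF.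
  move=> /(lt_le_trans h); rewrite fr.
  case: (f x) (fNy x) => [s _|_ _|//]; last exact: leey.
  rewrite -!EFinM -EFinD lte_fin lee_fin => hs.
  have -> : (`|x - x0| / d = t^-1)%R by rewrite /t [RHS]invf_div.
  have : (t * (r - s) < 1)%R by nra.
  by rewrite mulrC -ltr_pdivlMr// mul1r => hh; lra.
exists (`|r| + 1 + `|x0| / d + d^-1)%R => x.
apply: le_trans (main x); rewrite lee_fin.
have h1 : (`|x - x0| / d <= `|x| / d + `|x0| / d)%R.
  by rewrite -mulrDl ler_pM2r ?invr_gt0// ler_normB.
have h2 : (- `|r| <= r)%R by rewrite lerNl -normrN ler_norm.
have h3 : (0 <= (`|r| + 1 + `|x0| / d) * `|x|)%R.
  by rewrite mulr_ge0// !addr_ge0// divr_ge0// ltW.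
have h4 : (0 <= d^-1)%R by rewrite invr_ge0 ltW.
have h5 : (`|x| / d = d^-1 * `|x|)%R by rewrite mulrC.
by rewrite mulrDl; lra.
Qed.

Lemma legendre_minorant f : proper_convex_lsc f ->
  exists C : R, forall y, - (C + C * `|y|)%:E <= legendre f y.
Proof.
move=> [_ [x0 fx0]].
pose r := fine (f x0); have fr : f x0 = r%:E by rewrite fineK.
exists (`|r| + `|x0|)%R => y.
apply: (@le_trans _ _ ((x0 * y)%:E - f x0)); last by apply: ereal_sup_ubound; exists x0.
rewrite fr -EFinB lee_fin.
have h1 : (- (`|x0| * `|y|) <= x0 * y)%R by rewrite -normrM lerNl -normrN ler_norm.
have h2 : (r <= `|r|)%R by rewrite ler_norm.
have h3 : (0 <= `|r| * `|y|)%R by rewrite mulr_ge0.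
by have := normr_ge0 x0; rewrite mulrDl; lra.
Qed.

(** The exclusion of [-oo] matters because [+oo - oo] is [-oo] in extended reals. *)
Lemma young_legendre f x y : (forall x, f x != -oo) -> legendre f y != -oo ->
  (x * y)%:E <= f x + legendre f y.
Proof.
move=> fNy lNy.
have : (x * y)%:E - f x <= legendre f y by apply: ereal_sup_ubound; exists x.
case: (f x) (fNy x) => [r _|_ _|//].
  by rewrite leeBlDl.
by rewrite addye// leey.
Qed.

Lemma legendre_lsc f : (forall x, f x != -oo) -> lower_semicontinuous (legendre f).
Proof.
move=> fNy y a /ereal_sup_gt[_ [x _ <-]].
case E : (f x) (fNy x) => [r| |] //= _; rewrite -EFinB lte_fin => h.
pose e := ((x * y - r - a) / (`|x| + 1))%R.
have e0 : (0 < e)%R by rewrite divr_gt0 ?subr_gt0// ltr_wpDl.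
exists (ball (y : R^o) e); first exact: nbhsx_ballx.
move=> z; rewrite /ball/= => yz.
apply: (@lt_le_trans _ _ ((x * z)%:E - f x)); last by apply: ereal_sup_ubound; exists x.
rewrite E -EFinB lte_fin.
have : (x * (y - z) < x * y - r - a)%R.
  apply: (le_lt_trans (ler_norm _)); rewrite normrM.
  apply: (@le_lt_trans _ _ ((`|x| + 1) * `|y - z|)%R).
    by rewrite ler_wpM2r// lerDl.
  by rewrite mulrC -ltr_pdivlMr// ltr_wpDl.
by lra.
Qed.

Section transport.
Variables (nu1 nu2 : probability (measurableTypeR R) R) (u1 u2 : R -> R).
Hypotheses (mu1 : measurable_fun half_unit u1) (mu2 : measurable_fun half_unit u2).
Hypotheses (nu1u1 : sym_law nu1 u1) (nu2u2 : sym_law nu2 u2).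
Hypothesis u1_ge0 : forall t, half_unit t -> (0 <= u1 t)%R.
Hypothesis u2_ge0 : forall t, half_unit t -> (0 <= u2 t)%R.
Hypothesis u1_fin : \int[mu]_(t in half_unit) (u1 t)%:E < +oo.
Hypothesis u2_fin : \int[mu]_(t in half_unit) (u2 t)%:E < +oo.

(** The minorants given by [affine_minorant] and [legendre_minorant] are integrable
    because the law has a finite first moment. *)
Lemma integrable_affine_sym_law (P : probability (measurableTypeR R) R) (u : R -> R) (C : R) :
  measurable_fun half_unit u -> sym_law P u -> (forall t, half_unit t -> (0 <= u t)%R) ->
  \int[mu]_(t in half_unit) (u t)%:E < +oo ->
  P.-integrable setT (fun x => (C + C * `|x|)%:E).
Proof.
move=> mu_ Pu u0 ufin.
have mabs : measurable_fun setT (fun x : measurableTypeR R => (`|x|%R)%:E).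
  exact/measurable_EFinP.
have iabs : P.-integrable setT (fun x => (`|x|%R)%:E).
  apply/integrableP; split => //.
  rewrite (ge0_integral_sym_law mu_ Pu)//; last exact: measurableT_comp.
  have E : \int[mu]_(t in half_unit) `|(`|u t|%R)%:E| = \int[mu]_(t in half_unit) (u t)%:E.
    by apply: eq_integral => t; rewrite inE => ht /=; rewrite normr_id ger0_norm// u0.
  rewrite E.
  under [X in _ + X]eq_integral do rewrite /= normrN.
  by rewrite E lte_add_pinfty.
under eq_fun do rewrite EFinD EFinM.
apply: integrableD => //; last exact: integrableZl.
exact: finite_measure_integrable_cst.
Qed.

(** Weak duality for the coupling [(u1 t, u2 t)], [(- u1 t, - u2 t)]: Young's
    inequality holds at both points and the two products agree. *)
Lemma le_transport_cost :
  2%:E * \int[mu]_(t in half_unit) (u1 t * u2 t)%:E <= transport_cost nu1 nu2.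
Proof.
apply: le_ereal_inf_tmp => _ [f ff <-].
have [[fNy fconv flsc] [x0 fx0]] := ff.
have [C1 hC1] := affine_minorant ff.
have [C2 hC2] := legendre_minorant ff.
have mf : measurable_fun setT (f : measurableTypeR R -> \bar R).
  exact: lower_semicontinuous_measurable.
have ml : measurable_fun setT (legendre f : measurableTypeR R -> \bar R).
  by apply: lower_semicontinuous_measurable; exact: legendre_lsc.
have lNy y : legendre f y != -oo.
  by rewrite -ltNye; apply: lt_le_trans (hC2 y); exact: ltNyr.

have I1 := integrable_affine_sym_law C1 mu1 nu1u1 u1_ge0 u1_fin.
have I2 := integrable_affine_sym_law C2 mu2 nu2u2 u2_ge0 u2_fin.
have := integrable_or_integral_pinfty measurableT mf I1 (fun x _ => hC1 x).
have := integrable_or_integral_pinfty measurableT ml I2 (fun x _ => hC2 x).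
case=> [J2|E2]; case=> [J1|E1]; last 3 first.
- have := integrable_fin_num measurableT J2.
  by rewrite E1; case: (\int[nu2]_y _) => //= r _; rewrite leey.
- have := integrable_fin_num measurableT J1.
  by rewrite E2; case: (\int[nu1]_y _) => //= r _; rewrite leey.
- by rewrite E1 E2 leey.
have [a1 a2 ->] := integral_sym_law mu1 nu1u1 mf J1.
have [b1 b2 ->] := integral_sym_law mu2 nu2u2 ml J2.
rewrite addeACA -(integralD measurable_half_unit a1 b1) -(integralD measurable_half_unit a2 b2).
have muu : measurable_fun half_unit (fun t => (u1 t * u2 t)%:E).
  by apply/measurable_EFinP; exact: measurable_funM.
rewrite mule_natl mule2n; apply: leeD.
- apply: ge0_le_integral => //.
  + exact: measurable_half_unit.
  + by move=> t ht; rewrite lee_fin mulr_ge0 ?u1_ge0 ?u2_ge0.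
  + by apply: emeasurable_funD; [exact: measurable_int a1|exact: measurable_int b1].
  + by move=> t ht; exact: young_legendre.
- apply: ge0_le_integral => //.
  + exact: measurable_half_unit.
  + by move=> t ht; rewrite lee_fin mulr_ge0 ?u1_ge0 ?u2_ge0.
  + by apply: emeasurable_funD; [exact: measurable_int a2|exact: measurable_int b2].
  + by move=> t ht; rewrite -mulrNN; exact: young_legendre.
Qed.

End transport.
End Duality.

(** * Concave profiles *)
Section Profile.
Context {R : realType}.
Notation mu := (@lebesgue_measure R).
Local Notation half := (@half_unit R).

(** One half of the isoperimetric profile of a symmetric log-concave measure with an
    essentially continuous density, as a function of the tail mass. *)
Definition profile (I u : R -> R) : Prop :=
  [/\ supergradient 2^-1 I u,
      forall t : R, 0 < t < 2^-1 -> 0 <= u t,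
      forall t : R, 0 < t < 2^-1 -> 0 < I t &
      vanishes_at0 2^-1 I].

Section profile_theory.
Variables I u : R -> R.
Hypothesis Iu : profile I u.

Lemma profile_slope_measurable : measurable_fun half u.
Proof.
have [Iu' _ _ _] := Iu; apply: (supergradient_measurable Iu').
  exact: interval_is_interval.
by move=> x; rewrite half_unitP.
Qed.

Lemma profile_nondecreasing (s t : R) : 0 < s -> s <= t -> t < 2^-1 -> I s <= I t.
Proof.
move=> s0; rewrite le_eqVlt => /orP[/eqP -> //|st] t2; have [Iu' u0 _ _] := Iu.
have /andP[+ _] := Iu' s t s0 st t2.
have : 0 <= u t * (t - s).
  by rewrite mulr_ge0 ?u0 ?(lt_trans s0 st)//= subr_ge0 ltW.
lra.
Qed.

Lemma profile_measurable : measurable_fun half I.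
Proof.
apply: monotone_measurable; first exact: interval_is_interval.
move=> x y; rewrite !half_unitP => /andP[x0 _] /andP[_ y2] xy.
exact: profile_nondecreasing.
Qed.

(** A positive concave function on (0, 1/2) lies above a linear one and is bounded;
    this makes [ln (I t)] integrable. *)
Lemma profile_bounds : exists c C : R,
  [/\ 0 < c, 0 < C & forall t, 0 < t < 2^-1 -> c * t <= I t <= C].
Proof.
have [Iu' u0 I0 v] := Iu.
pose q : R := 4^-1.
have q0 : 0 < q by rewrite invr_gt0.
have q2 : q < 2^-1 by rewrite /q; lra.
have Iq : 0 < I q by rewrite I0// q0.
have uq : 0 <= u q by rewrite u0// q0.
have Ige0 t : 0 < t < 2^-1 -> 0 <= I t by move=> /I0/ltW.
exists (I q), (I q + u q); split => //; first by rewrite ltr_wpDr.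
move=> t /andP[t0 t2].
have [tq|qt] := leP t q.
- have h : I t <= I q by exact: profile_nondecreasing.
  apply/andP; split; last by lra.
  move: tq; rewrite le_eqVlt => /orP[/eqP <-|tq].
    have : I t * t <= I t * 1 by rewrite ler_pM2l ?I0 ?t0//; lra.
    lra.
  have /andP[_ h1] := Iu' t q t0 tq q2.
  have := mul_supergradient_le Iu' u0 Ige0 (t := t); rewrite t0 t2 => /(_ isT) h2.
  have h3 : u t * (q - t) * t <= I t * (q - t) by nra.
  have h4 : (I q - I t) * t <= I t * (q - t) by nra.
  have h5 : I q * t <= I t * q by nra.
  have : I t * q <= I t * 1 by rewrite ler_pM2l ?I0 ?t0//; lra.
  lra.
- have h : I q <= I t by apply: profile_nondecreasing => //; exact: ltW.
  have /andP[_ h1] := Iu' q t q0 qt t2.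
  apply/andP; split; first by nra.
  have : u q * (t - q) <= u q * 1 by rewrite ler_wpM2l//; lra.
  lra.
Qed.

Local Open Scope ereal_scope.

Lemma integral_profile_slope (C : R) : (forall t : R, 0 < t < 2^-1 -> I t <= C)%R ->
  \int[mu]_(t in half) (u t)%:E <= C%:E.
Proof.
move=> IC; have [Iu' u0 I0 v] := Iu.
have q2 : (0 < (4^-1 : R) < 2^-1)%R by rewrite invr_gt0 ltr0n/=; lra.
have C0 : (0 <= C)%R by rewrite (le_trans _ (IC _ q2))// ltW// I0.
have -> : C = Num.max 0%R C by apply/esym/max_idPr.
apply: exhaust_integral_le.
- by apply/measurable_EFinP; exact: profile_slope_measurable.
- by move=> x xh; rewrite lee_fin u0.
- move=> s t s0 st t2; rewrite (integral_supergradient Iu')// lee_fin.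
  have Is : (0 < I s)%R by rewrite I0// s0 (lt_trans st).
  by have := IC t; rewrite t2 (lt_trans s0 st) => /(_ isT); lra.
Qed.

Lemma integral_profile_slope_lty : \int[mu]_(t in half) (u t)%:E < +oo.
Proof.
have [c [C [_ _ cC]]] := profile_bounds.
apply: (@le_lt_trans _ _ C%:E); last exact: ltry.
by apply: integral_profile_slope => t /cC/andP[].
Qed.

Lemma integral_neg_ln_half :
  \int[mu]_(t in half) (- ln t)%:E = (2^-1 + 2^-1 * ln 2)%:E.
Proof.
rewrite integral_ln ?invr_gt0 ?ltr0n ?invf_lt1 ?ltr0n ?ltr1n//.
by rewrite lnV ?posrE// mulrN opprK.
Qed.

Lemma integrable_ln_half : mu.-integrable half (fun t => (ln t)%:E).
Proof.
have mln : measurable_fun half (fun t => (ln t)%:E).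
  by apply/measurable_EFinP; apply: measurable_funS (@measurable_ln R).
apply/integrableP; split => //.
rewrite (_ : \int[mu]_(t in half) _ = \int[mu]_(t in half) (- ln t)%:E).
  by rewrite integral_neg_ln_half ltry.
apply: eq_integral => t; rewrite inE half_unitP => /andP[t0 t1] /=.
by rewrite ler0_norm// ln_le0//; lra.
Qed.

Lemma integrable_cst_half (k : R) : mu.-integrable half (fun=> k%:E).
Proof.
apply/integrableP; split=> //.
by rewrite integral_cst /= ?half_unit_length ?ltry//; exact: measurable_half_unit.
Qed.

Lemma integrable_ln_profile : mu.-integrable half (fun t => (ln (I t))%:E).
Proof.
have [c [C [c0 C0 cC]]] := profile_bounds.
have Ii : mu.-integrable half (fun t => (`|ln c|%R + `|ln C|%R)%:E - (ln t)%:E).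
  apply: integrableB => //.
  - exact: measurable_half_unit.
  - exact: integrable_cst_half.
  - exact: integrable_ln_half.
apply: le_integrable Ii => //.
- exact: measurable_half_unit.
- apply/measurable_EFinP; apply: measurableT_comp => //.
  exact: profile_measurable.
- move=> t; rewrite half_unitP => th; have /andP[t0 t2] := th.
  have [_ _ I0 _] := Iu; have It := I0 t th.
  have /andP[h1 h2] := cC t th.
  have l1 : (ln c + ln t <= ln (I t))%R.
    by rewrite -lnM ?posrE// ler_ln ?posrE// mulr_gt0.
  have l2 : (ln (I t) <= ln C)%R by rewrite ler_ln ?posrE.
  have l3 : (ln t <= 0)%R by rewrite ln_le0//; lra.
  rewrite /= lee_fin.
  have := ler_norm (ln C); have := ler_norm (- ln c)%R; rewrite normrN => h3 h4.
  have h5 := normr_ge0 (ln c); have h6 := normr_ge0 (ln C).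
  rewrite [leRHS]ger0_norm; last by lra.
  by rewrite ler_norml; apply/andP; split; lra.
Qed.

End profile_theory.

Local Open Scope ereal_scope.

(** The heart of the matter: by Chebyshev's inequality [I1 t * I2 t <= t * m], where
    [m] is the integral of [u1 u2], so the left-hand side is at most
    [ln m - 1 - ln 2]; the rest is [ln (2 * m) <= 2 * m - 1]. *)
Lemma profile_inequality (I1 u1 I2 u2 : R -> R) : profile I1 u1 -> profile I2 u2 ->
  2%:E * \int[mu]_(t in half) (ln (I1 t))%:E + 2%:E * \int[mu]_(t in half) (ln (I2 t))%:E
   <= (- ln (4 * expR 1 ^+ 2))%:E + 2%:E * \int[mu]_(t in half) (u1 t * u2 t)%:E.
Proof.
move=> P1 P2; have [Iu1 u10 I10 v1] := P1; have [Iu2 u20 I20 v2] := P2.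
have u120 t : half t -> 0 <= (u1 t * u2 t)%:E.
  by rewrite half_unitP => ht; rewrite lee_fin mulr_ge0 ?u10 ?u20.
have mu12 : measurable_fun half (fun t => (u1 t * u2 t)%:E).
  apply/measurable_EFinP; apply: measurable_funM.
    exact: profile_slope_measurable P1.
  exact: profile_slope_measurable P2.
have u12_ge0 : 0 <= \int[mu]_(t in half) (u1 t * u2 t)%:E by exact: integral_ge0.
move: (u12_ge0).
case E : (\int[mu]_(t in half) (u1 t * u2 t)%:E) => [m| |] //.
  2: by move=> _; rewrite gt0_muley ?lte_fin// addey// leey.
move=> _.
have Im t : (0 < t < 2^-1)%R -> (I1 t * I2 t <= t * m)%R.
  move=> ht; have /andP[t0 t2] := ht.
  have H : (I1 t * I2 t)%:E <= t%:E * \int[mu]_(x in `]0%R, t[) (u1 x * u2 x)%:E.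
    apply: (chebyshev_supergradient Iu1 Iu2) => // x xh; first exact/ltW/I10.
    exact/ltW/I20.
  rewrite -lee_fin; apply: (le_trans H); rewrite EFinM -E.
  rewrite lee_pmul2l// ?lte_fin//; apply: ge0_subset_integral => //.
    exact: measurable_half_unit.
  by move=> x /=; rewrite half_unitP in_itv/= => /andP[->] /lt_trans; exact.
have m0 : (0 < m)%R.
  have q2 : (0 < (4^-1 : R) < 2^-1)%R by rewrite invr_gt0 ltr0n/=; lra.
  have := Im _ q2; have := mulr_gt0 (I10 _ q2) (I20 _ q2); lra.
have L1 := integrable_ln_profile P1; have L2 := integrable_ln_profile P2.
have mh := measurable_half_unit (R := R).
have Lm : mu.-integrable half (fun t => (ln m)%:E + (ln t)%:E).
  by apply: integrableD => //; [exact: integrable_cst_half|exact: integrable_ln_half].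
have : \int[mu]_(t in half) ((ln (I1 t))%:E + (ln (I2 t))%:E) <=
       \int[mu]_(t in half) ((ln m)%:E + (ln t)%:E).
  apply: le_integral => //; first exact: integrableD.
  move=> t; rewrite inE half_unitP => ht; have /andP[t0 _] := ht.
  have i1 := I10 _ ht; have i2 := I20 _ ht.
  rewrite -!EFinD lee_fin -!lnM ?posrE// ler_ln ?posrE ?mulr_gt0//.
  by rewrite [leRHS]mulrC Im.
rewrite integralD// integralD//; [|exact: integrable_cst_half|exact: integrable_ln_half].
have -> : \int[mu]_(t in half) (ln t)%:E = (- (2^-1 + 2^-1 * ln 2))%:E.
  rewrite EFinN -integral_neg_ln_half -integral_ge0N.
    by under [RHS]eq_integral do rewrite EFinN oppeK.
  move=> t; rewrite half_unitP lee_fin => /andP[t0 t2].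
  by apply: neg_ln_ge0; rewrite t0; lra.
rewrite integral_cst//= half_unit_length.
move: (integrable_fin_num mh L1) (integrable_fin_num mh L2).
case: (\int[mu]_(t in half) _) => [a| |] // _.
case: (\int[mu]_(t in half) _) => [b| |] // _.
rewrite -!EFinM -!EFinD !lee_fin => H.
have E1 : (expR (1 : R) ^+ 2 = expR 2)%R by rewrite -expRM_natl mulr1.
rewrite lnM ?posrE ?exprn_gt0 ?expR_gt0// E1 expRK.
have -> : (ln (4 : R) = 2 * ln 2)%R.
  by rewrite (_ : 4 = 2 ^+ 2 :> R)%R ?lnXn// ?mulr_natl//; rewrite expr2; ring.
have := @ln_le_subr1 R (2 * m)%R; rewrite lnM ?posrE// => /(_ _).
have -> : (0 < 2 * m)%R by rewrite mulr_gt0.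
by move=> /(_ isT) h; lra.
Qed.

End Profile.

(** * Slopes of even convex potentials *)
Lemma countable_setU T (A B : set T) : countable A -> countable B -> countable (A `|` B).
Proof.
move=> cA cB; have -> : A `|` B = \bigcup_(b in [set: bool]) (if b then A else B).
  apply/seteqP; split=> [x [Ax|Bx]|x [[] _ h]]; [by exists true|by exists false|by left|by right].
by apply: bigcup_countable => [|[] _]; first exact: countableP.
Qed.

Section EvenConvex.
Context {R : realType}.
Variable V : R -> \bar R.

Definition edom : set R := [set x | (V x < +oo)%E].

Local Notation v := (fine \o V).

Hypothesis VNy : forall x, (V x != -oo)%E.
Hypothesis Vconv : econvex_function V.
Hypothesis Vsym : forall x, V (- x) = V x.

Lemma edomE x : edom x -> V x = (v x)%:E.
Proof. by move=> dx; rewrite /= fineK// fin_numE VNy/= -ltey. Qed.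

(** A point between [- y] and [y] is a convex combination of them, and [V] takes the
    same value at both. *)
Lemma convex_even_le (x y : R) : `|x| <= `|y| -> (V x <= V y)%E.
Proof.
have [->|y0] := eqVneq y 0.
  by rewrite normr0 normr_le0 => /eqP ->.
move=> xy.
pose t := (x / y + 1) / 2.
have ry : `|x / y| <= 1 by rewrite normf_div ler_pdivrMr ?normr_gt0// mul1r.
have /andP[r1 r2] : -1 <= x / y <= 1 by rewrite -ler_norml.
have t0 : 0 <= t by rewrite divr_ge0//; lra.
have t1 : t <= 1 by rewrite /t ler_pdivrMr//; lra.
have t01 : 0 <= t <= 1 by rewrite t0.
have := Vconv y (- y) t01; rewrite Vsym -ge0_muleDl ?lee_fin ?subr_ge0//.
rewrite -EFinD [X in (X%:E * _)%E](_ : _ = 1)%R ?mul1e; last by ring.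
have -> // : t * y + (1 - t) * - y = x.
by rewrite /t; field.
Qed.

Lemma edom_le (x y : R) : `|x| <= `|y| -> edom y -> edom x.
Proof. by move=> /convex_even_le xy; apply: le_lt_trans. Qed.

Lemma fine_even_le (x y : R) : `|x| <= `|y| -> edom y -> v x <= v y.
Proof.
move=> xy dy; have dx := edom_le xy dy.
by have := convex_even_le xy; rewrite (edomE dx) (edomE dy).
Qed.

Lemma fine_conv (x y t : R) : edom x -> edom y -> 0 <= t <= 1 ->
  edom (t * x + (1 - t) * y) /\ v (t * x + (1 - t) * y) <= t * v x + (1 - t) * v y.
Proof.
move=> dx dy t01; have := Vconv x y t01.
rewrite (edomE dx) (edomE dy) -!EFinM -EFinD => h.
have dz : edom (t * x + (1 - t) * y) by apply: le_lt_trans h _; exact: ltry.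
by split=> //; move: h; rewrite (edomE dz).
Qed.

Lemma three_slopes (x y z : R) : edom x -> edom z -> x < y -> y < z ->
  (v y - v x) * (z - y) <= (v z - v y) * (y - x).
Proof.
move=> dx dz xy yz.
pose t := (z - y) / (z - x).
have zx : 0 < z - x by rewrite subr_gt0 (lt_trans xy).
have t01 : 0 <= t <= 1.
  apply/andP; split; first by apply: divr_ge0; lra.
  by rewrite ler_pdivrMr//; lra.
have [] := fine_conv dx dz t01.
have -> : t * x + (1 - t) * z = y by rewrite /t; field; rewrite gt_eqF.
move=> dy h.
have tz : t * (z - x) = z - y by rewrite divfK// gt_eqF.
have : v y * (z - x) <= (z - y) * v x + (y - x) * v z.
  have -> : (z - y) * v x + (y - x) * v z = (t * v x + (1 - t) * v z) * (z - x).
    have -> : (t * v x + (1 - t) * v z) * (z - x) =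
      (t * (z - x)) * v x + ((z - x) - t * (z - x)) * v z by ring.
    by rewrite tz; ring.
  by rewrite ler_pM2r.
nra.
Qed.

(** The right derivative of [V], as the infimum of the slopes of chords to the right:
    for [x >= 0] these are nonnegative, so the infimum is bounded below. *)
Definition right_slope (x : R) : R :=
  inf [set (v y - v x) / (y - x) | y in [set y | x < y /\ edom y]].

Section slope.
Variable x : R.
Hypotheses (x0 : 0 <= x) (dx : edom x).

Let slopes := [set (v y - v x) / (y - x) | y in [set y | x < y /\ edom y]].

Let slopes_ge0 : lbound slopes 0.
Proof.
move=> _ [y [xy dy] <-]; have y0 : 0 <= y by exact: le_trans x0 (ltW xy).
apply: divr_ge0; rewrite subr_ge0; last exact: ltW.
by apply: fine_even_le => //; rewrite !ger0_norm// ltW.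
Qed.

Lemma right_slope_le (y : R) : x < y -> edom y -> right_slope x * (y - x) <= v y - v x.
Proof.
move=> xy dy; rewrite -ler_pdivlMr ?subr_gt0//.
by apply: ge_inf; [exists 0; exact: slopes_ge0|exists y].
Qed.

Hypothesis dright : exists2 y, x < y & edom y.

Let slopes0 : slopes !=set0.
Proof. by have [y xy dy] := dright; exists ((v y - v x) / (y - x)); exists y. Qed.

Lemma right_slope_ge0 : 0 <= right_slope x.
Proof. exact: lb_le_inf slopes0 slopes_ge0. Qed.

Lemma left_le_right_slope (y : R) : y < x -> edom y -> v x - v y <= right_slope x * (x - y).
Proof.
move=> yx dy; rewrite -ler_pdivrMr ?subr_gt0//.
apply: lb_le_inf; first exact: slopes0.
move=> _ [z [xz dz] <-]; rewrite ler_pdivrMr ?subr_gt0// mulrAC ler_pdivlMr ?subr_gt0//.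
exact: three_slopes.
Qed.

End slope.

Hypothesis dopen : forall x : R, 0 <= x -> edom x -> exists2 y : R, x < y & edom y.

Lemma right_slope_mono (x y : R) : 0 <= x -> x <= y -> edom y -> right_slope x <= right_slope y.
Proof.
move=> x0; rewrite le_eqVlt => /orP[/eqP -> //|xy] dy.
have dx : edom x by apply: edom_le dy; rewrite !ger0_norm//; lra.
have y0 : 0 <= y by lra.
have h1 := right_slope_le x0 xy dy.
have h2 := left_le_right_slope (dopen y0 dy) xy dx.
by rewrite -(@ler_pM2r _ (y - x)) ?subr_gt0// (le_trans h1).
Qed.

(** Discontinuities of [right_slope] come with an explicit gap [e]: a rational
    number in the gap identifies the point, and away from such points the
    difference quotients of [V] are squeezed. *)
Definition slope_jump : set R := [set x | [/\ 0 < x, edom x &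
  exists2 e, 0 < e & (forall y, x < y -> edom y -> right_slope x + e <= right_slope y) \/
                     (forall y, 0 < y -> y < x -> right_slope y <= right_slope x - e)]].

(** Gaps at different points are disjoint because [right_slope] is nondecreasing. *)
Lemma countable_slope_jump : countable slope_jump.
Proof.
pose Jr := [set x | [/\ 0 < x, edom x & exists2 e, 0 < e &
  forall y, x < y -> edom y -> right_slope x + e <= right_slope y]].
pose Jl := [set x | [/\ 0 < x, edom x & exists2 e, 0 < e &
  forall y, 0 < y -> y < x -> right_slope y <= right_slope x - e]].
apply: (@sub_countable _ _ _ (Jr `|` Jl)).
  apply: subset_card_le => x [x0 dx [e e0 [h|h]]].
  - by left; split => //; exists e.
  - by right; split => //; exists e.
have rat_inj (A : set R) (g : R -> rat) : {in A &, forall x y, x < y -> g x < g y} -> countable A.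
  move=> gA; apply/countable_injP; exists (pickle \o g) => x y xA yA /= /(pcan_inj pickleK) gxy.
  by have [/(gA _ _ xA yA)|/(gA _ _ yA xA)|//] := ltgtP x y; rewrite gxy ltxx.
apply: countable_setU.
  have H x : exists q : rat, Jr x -> right_slope x < ratr q /\
      (forall y, x < y -> edom y -> ratr q < right_slope y).
    have [[x0 dx [e e0 h]]|nJ] := pselect (Jr x); last by exists 0.
    have [q] := rat_in_itvoo (ltr_pwDr e0 (lexx (right_slope x))).
    rewrite in_itv/= => /andP[q1 q2]; exists q => _; split => // y xy dy.
    exact: lt_le_trans q2 (h y xy dy).
  have [g gP] := choice H.
  apply: (rat_inj _ g) => x y /set_mem xA /set_mem yA xy; rewrite -(ltr_rat R).
  have [_ h] := gP x xA; have [h' _] := gP y yA.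
  by apply: lt_trans h'; apply: h => //; case: yA.
have H x : exists q : rat, Jl x -> ratr q < right_slope x /\
    (forall y, 0 < y -> y < x -> right_slope y < ratr q).
  have [[x0 dx [e e0 h]]|nJ] := pselect (Jl x); last by exists 0.
  have eN : right_slope x - e < right_slope x by lra.
  have [q] := rat_in_itvoo eN.
  rewrite in_itv/= => /andP[q1 q2]; exists q => _; split => // y y0 yx.
  exact: le_lt_trans (h y y0 yx) q1.
have [g gP] := choice H.
apply: (rat_inj _ g) => x y /set_mem xA /set_mem yA xy; rewrite -(ltr_rat R).
have [h _] := gP x xA; have [_ h'] := gP y yA.
by apply: lt_trans h _; apply: h' => //; case: xA.
Qed.

(** Difference quotients at [x] lie between the slopes at [x] and at a nearby point,
    and these are close since [right_slope] is continuous at [x]. *)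
Lemma slope_quotient_close (x : R) : 0 < x -> edom x -> ~ slope_jump x ->
  forall e : R, 0 < e -> exists2 r : R, 0 < r & forall h : R, h != 0 -> `|h| < r ->
    `|right_slope x - h^-1 * (v (h + x) - v x)| <= e.
Proof.
move=> x0 dx nJ e.
move=> e0.
have [y1 [xy1 dy1 Dy1]] : exists y, [/\ x < y, edom y & right_slope y < right_slope x + e].
  apply: contrapT => H; apply: nJ; split => //; exists e => //; left => y xy dy.
  by rewrite leNgt; apply/negP => h; apply: H; exists y.
have [y2 [y20 y2x Dy2]] : exists y, [/\ 0 < y, y < x & right_slope x - e < right_slope y].
  apply: contrapT => H; apply: nJ; split => //; exists e => //; right => y y0 yx.
  by rewrite leNgt; apply/negP => h; apply: H; exists y.
exists (Num.min (y1 - x) (x - y2)); first by rewrite lt_min !subr_gt0 xy1 y2x.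
move=> h h0; rewrite lt_min => /andP[h1 h2].
have x00 := ltW x0.
have [hp|hn|/eqP] := ltgtP 0 h; last by rewrite eq_sym (negbTE h0).
- have hy : h + x < y1 by have := ler_norm h; lra.
  have dh : edom (h + x) by apply: edom_le dy1; rewrite !ger0_norm; lra.
  have xh : x < h + x by lra.
  have q1 := right_slope_le x00 xh dh.
  have q2 := left_le_right_slope (dopen (ltW (lt_trans x0 xh)) dh) xh dx.
  have q3 := right_slope_mono (ltW (lt_trans x0 xh)) (ltW hy) dy1.
  have E : h + x - x = h by ring.
  rewrite E in q1 q2.
  have s1 : right_slope x <= h^-1 * (v (h + x) - v x).
    by rewrite mulrC ler_pdivlMr.
  have s2 : h^-1 * (v (h + x) - v x) <= right_slope (h + x).
    by rewrite mulrC ler_pdivrMr.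
  by rewrite ler_norml; apply/andP; split; lra.
- have hy : y2 < h + x by have := ler_norm (- h); rewrite normrN; lra.
  have xh : h + x < x by lra.
  have hx0 : 0 <= h + x by lra.
  have dh : edom (h + x) by apply: edom_le dx; rewrite !ger0_norm; lra.
  have q1 := right_slope_le hx0 xh dx.
  have q2 := left_le_right_slope (dopen x00 dx) xh dh.
  have q3 := right_slope_mono (ltW y20) (ltW hy) dh.
  have Q : h^-1 * (v (h + x) - v x) = (v x - v (h + x)) / (x - (h + x)).
    by field; apply/andP; split; rewrite ?h0//; lra.
  have xh0 : 0 < x - (h + x) by lra.
  have s1 : right_slope (h + x) <= h^-1 * (v (h + x) - v x).
    by rewrite Q ler_pdivlMr.
  have s2 : h^-1 * (v (h + x) - v x) <= right_slope x.
    by rewrite Q ler_pdivrMr.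
  by rewrite ler_norml; apply/andP; split; lra.
Qed.

Lemma derive_right_slope (x : R) : 0 < x -> edom x -> ~ slope_jump x ->
  derive1 v x = right_slope x.
Proof.
move=> x0 dx nJ; rewrite /derive1; apply: cvg_lim => //.
apply/cvgrPdist_le => e e0; have [r r0 H] := slope_quotient_close x0 dx nJ e0.
apply/nbhs_ballP; exists r => //= h.
rewrite /ball/= sub0r normrN => hr h0; exact: H.
Qed.

Lemma derive_right_slopeN (x : R) : 0 < x -> edom x -> ~ slope_jump x ->
  derive1 v (- x) = - right_slope x.
Proof.
move=> x0 dx nJ; rewrite /derive1; apply: cvg_lim => //.
apply/cvgrPdist_le => e e0; have [r r0 H] := slope_quotient_close x0 dx nJ e0.
apply/nbhs_ballP; exists r => //= h.
rewrite /ball/= sub0r normrN => hr h0.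
have -> : - right_slope x - h^-1 *: ((v (h - x)) - v (- x)) =
    - (right_slope x - (- h)^-1 * (v (- h + x) - v x)).
  have -> : v (h - x) = v (- h + x) by rewrite /= -Vsym; congr (fine (V _)); ring.
  have -> : v (- x) = v x by rewrite /= Vsym.
  by rewrite invrN /GRing.scale/=; ring.
by rewrite normrN; apply: H; rewrite ?oppr_eq0 ?normrN.
Qed.

Lemma derive_outside (x y : R) : 0 <= y -> y < `|x| -> ~ edom y -> derive1 v x = 0.
Proof.
move=> y0 yx ny; rewrite /derive1; apply: cvg_lim => //.
have out z : y < `|z| -> v z = 0.
  move=> yz; rewrite /=.
  suff -> : V z = +oo%E by [].
  apply/eqP; rewrite -leye_eq leNgt; apply/negP => dz; apply: ny.
  by apply: edom_le dz; rewrite ger0_norm// ltW.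
apply/cvgrPdist_le => e e0.
apply/nbhs_ballP; exists (`|x| - y); first by rewrite /= subr_gt0.
move=> h; rewrite /ball/= sub0r normrN => hr h0.
have hx : y < `|h + x|.
  have := ler_normB (h + x) h; have -> : h + x - h = x by ring.
  by lra.
by rewrite -/(v (h + x)) -/(v x) !out// subrr scaler0 subrr normr0 ltW.
Qed.

(** The odd extension of [right_slope]: an everywhere defined measurable version of
    the derivative of [fine \o V]. *)
Definition slope_ext (x : R) : R :=
  (right_slope \_ [set x | 0 < x /\ edom x]) x -
  ((fun x => right_slope (- x)) \_ [set x | x < 0 /\ edom x]) x.

Lemma slope_ext_pos x : 0 < x -> edom x -> slope_ext x = right_slope x.
Proof.
move=> x0 dx; rewrite /slope_ext !patchE mem_set ?memNset ?subr0// => -[/=].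
by rewrite ltNge ltW.
Qed.

Lemma slope_ext_neg x : x < 0 -> edom x -> slope_ext x = - right_slope (- x).
Proof.
move=> x0 dx; rewrite /slope_ext !patchE [x \in [set x | x < 0 /\ _]]mem_set// memNset ?sub0r// => -[/=].
by rewrite ltNge ltW.
Qed.

Lemma slope_ext_out x : ~ edom x -> slope_ext x = 0.
Proof. by move=> dx; rewrite /slope_ext !patchE !memNset ?subr0// => -[]. Qed.

Lemma measurable_slope_ext : measurable_fun setT slope_ext.
Proof.
have iP : is_interval [set x : R | 0 < x /\ edom x].
  move=> x y [x0 dx] [y0 dy] z /andP[xz zy]; split; first exact: lt_le_trans xz.
  by apply: edom_le dy; rewrite !ger0_norm//; lra.
have iN : is_interval [set x : R | x < 0 /\ edom x].
  move=> x y [x0 dx] [y0 dy] z /andP[xz zy]; split; first exact: le_lt_trans zy _.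
  by apply: edom_le dx; rewrite !ler0_norm//; lra.
have mP := is_interval_measurable iP; have mN := is_interval_measurable iN.
apply: measurable_funB.
- apply/(measurable_restrictT _ mP).
  apply: monotone_measurable => // x y [x0 dx] [y0 dy] xy.
  by apply: right_slope_mono => //; exact: ltW.
- apply/(measurable_restrictT _ mN).
  apply: antitone_measurable => // x y [x0 dx] [y0 dy] xy.
  apply: right_slope_mono; [lra|lra|].
  by rewrite /edom/= Vsym.
Qed.

(** The points where [derive1 (fine \o V)] may differ from [slope_ext]: jumps of the
    slope, the origin, and the two endpoints of the domain. *)
Definition kink : set R := [set x | slope_jump `|x|] `|` [set 0] `|`
  [set x | ~ edom x /\ forall y, 0 <= y -> y < `|x| -> edom y].

(** At most one nonnegative number is an endpoint of the domain. *)
Lemma countable_kink : countable kink.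
Proof.
have cnorm (A : set R) : countable A -> countable [set x : R | A `|x|].
  move=> cA; apply: (@sub_countable _ _ _ (A `|` -%R @` A)).
    apply: subset_card_le => x Ax; have [x0|x0] := leP 0 x.
      by left; rewrite -(ger0_norm x0).
    by right; exists `|x|; rewrite // ltr0_norm// opprK.
  by apply: countable_setU => //; apply: sub_countable cA; exact: card_image_le.
apply: countable_setU; first (apply: countable_setU; [exact/cnorm/countable_slope_jump|exact: countable1]).
pose E := [set x : R | [/\ 0 <= x, ~ edom x & forall y, 0 <= y -> y < x -> edom y]].
apply: (@sub_countable _ _ _ [set x : R | E `|x|]).
  apply: subset_card_le => x [ndx h]; split=> //= dx; apply: ndx.
  by apply: edom_le dx; rewrite normr_id.
apply: cnorm.
have [[x Ex]|nE] := pselect (E !=set0); last first.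
  by rewrite (_ : E = set0); [exact: countable0|rewrite -subset0 => x Ex; apply: nE; exists x].
rewrite (_ : E = [set x]); first exact: countable1.
apply/seteqP; split=> [y Ey|_ ->//].
case: Ex Ey => x0 ndx hx [y0 ndy hy].
have [xy|yx|//] := ltgtP x y; first by case: ndx; exact: hy.
by case: ndy; exact: hx.
Qed.

Lemma derive_slope_ext x : ~ kink x -> derive1 v x = slope_ext x.
Proof.
move=> nk; have [dx|ndx] := pselect (edom x).
  have nj : ~ slope_jump `|x| by move=> h; apply: nk; left; left.
  have [x0|x0|x0] := ltgtP 0 x.
  - rewrite slope_ext_pos//; apply: derive_right_slope => //.
    by rewrite -(gtr0_norm x0).
  - rewrite slope_ext_neg// -{1}(opprK x); apply: derive_right_slopeN.
    + by rewrite oppr_gt0.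
    + by rewrite /edom/= Vsym.
    + by rewrite -(ltr0_norm x0).
  - by exfalso; apply: nk; left; right; rewrite /= -x0.
rewrite slope_ext_out//.
have [y [y0 yx ny]] : exists y, [/\ 0 <= y, y < `|x| & ~ edom y].
  apply: contrapT => H; apply: nk; right; split => // y y0 yx.
  by apply: contrapT => ny; apply: H; exists y.
exact: derive_outside y0 yx ny.
Qed.

(** The derivative takes unspecified values at the kinks, but any set of kinks is
    countable, hence measurable. *)
Lemma measurable_derive_fine : measurable_fun setT (derive1 v).
Proof.
move=> _ A mA; rewrite setTI.
have ck (B : set R) : measurable (B `&` kink).
  apply: countable_measurable => [t|]; first exact: measurable_set1.
  apply: sub_countable countable_kink.
  by apply: subset_card_le => x [].
rewrite (_ : _ @^-1` _ = (slope_ext @^-1` A `&` ~` kink) `|` (derive1 v @^-1` A `&` kink)).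
  apply: measurableU => //; apply: measurableI.
    by rewrite -[X in measurable X]setTI; exact: measurable_slope_ext.
  by apply: measurableC; rewrite -[X in measurable X]setTI.
apply/seteqP; split=> x /=.
- move=> h; have [k|k] := pselect (kink x); [by right|left].
  by rewrite -derive_slope_ext.
- by move=> [[h k]|[]//]; rewrite derive_slope_ext.
Qed.

End EvenConvex.

(** * Symmetric log-concave measures *)
Section LogConcave.
Context {R : realType}.
Notation mu := (@lebesgue_measure R).
Variables (eta : probability (measurableTypeR R) R) (V : R -> \bar R).
Hypothesis etaV : log_concave_with eta V.

Local Notation v := (fine \o V).

Definition density (x : R) : R := fine (expeR (- V x)).
Local Notation f := density.

Let VNy : forall x, (V x != -oo)%E. Proof. by have [[]] := etaV. Qed.
Let Vconv : econvex_function V. Proof. by have [[]] := etaV. Qed.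
Let Vlsc : lower_semicontinuous V. Proof. by have [[]] := etaV. Qed.

Lemma density_ge0 x : 0 <= f x.
Proof. exact/fine_ge0/expeR_ge0. Qed.

Lemma densityE x : expeR (- V x) = (f x)%:E.
Proof. by rewrite /f; case: (V x) (VNy x) => [r| |]. Qed.

Lemma density_gt0E x : edom V x -> f x = expR (- v x).
Proof. by move=> dx; rewrite /f (edomE VNy dx). Qed.

Lemma density_out x : ~ edom V x -> f x = 0.
Proof.
move=> dx; rewrite /f; suff -> : V x = +oo%E by [].
by apply/eqP; rewrite -leye_eq leNgt; apply/negP.
Qed.

Lemma density_gt0 x : (0 < f x) <-> edom V x.
Proof.
split; last by move=> dx; rewrite density_gt0E// expR_gt0.
by move=> fx; apply: contrapT => /density_out f0; rewrite f0 ltxx in fx.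
Qed.

Lemma measurable_potential : measurable_fun setT (V : measurableTypeR R -> \bar R).
Proof. exact: lower_semicontinuous_measurable. Qed.

(** Lower semicontinuity of [V] makes the density upper semicontinuous. *)
Lemma measurable_density : measurable_fun setT (f : measurableTypeR R -> R).
Proof.
have h : lower_semicontinuous (fun x => (- f x)%:E).
  move=> x a; rewrite lte_fin ltrNr => fa.
  have a0 : 0 < - a by exact: le_lt_trans (density_ge0 x) fa.
  have ltE z : (f z < - a) <-> ((- ln (- a))%:E < V z)%E.
    have [dz|nz] := pselect (edom V z).
      have lnE : (- v z < ln (- a)) = (expR (- v z) < - a).
        by rewrite -[LHS]ltr_expR lnK ?posrE.
      by rewrite density_gt0E// (edomE VNy dz) lte_fin ltrNl lnE.
    rewrite density_out//; split=> // _.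
    by rewrite (lt_le_trans (ltry _))// leNgt; apply/negP.
  have [W Wx VW] := Vlsc ((ltE x).1 fa).
  by exists W => // y Wy; rewrite lte_fin ltrNr; apply/ltE/VW.
have mN := lower_semicontinuous_measurable h.
have -> : f = fun x => - (- f x) by apply/funext => x; rewrite opprK.
by apply/measurable_funN; apply/measurable_EFinP.
Qed.

Lemma eta_density (A : set (measurableTypeR R)) : measurable A ->
  eta A = (\int[mu]_(x in A) (f x)%:E)%E.
Proof.
move=> mA; have [_ ->//] := etaV.
by apply: eq_integral => x _; rewrite densityE.
Qed.

Let mfE A : measurable_fun A (fun x : measurableTypeR R => (f x)%:E).
Proof. by apply/measurable_EFinP; apply: measurable_funS measurable_density. Qed.

Lemma eta_itv_ge (c a b : R) : a <= b -> (forall x, a < x < b -> c <= f x) -> 0 <= c ->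
  ((c * (b - a))%:E <= eta `]a, b[%classic)%E.
Proof.
move=> ab cf c0; rewrite eta_density//.
have -> : ((c * (b - a))%:E = \int[mu]_(x in `]a, b[) c%:E)%E.
  rewrite integral_cst//= lebesgue_measure_itv/= lte_fin.
  move: ab; rewrite le_eqVlt => /orP[/eqP->|ab]; last by rewrite ab -EFinB -EFinM.
  by rewrite ltxx subrr mulr0 mule0.
apply: ge0_le_integral => //.
Qed.

Lemma eta_itv_le (c a b : R) : a <= b -> (forall x, a < x < b -> f x <= c) -> 0 <= c ->
  (eta `]a, b[%classic <= (c * (b - a))%:E)%E.
Proof.
move=> ab cf c0; rewrite eta_density//.
have -> : ((c * (b - a))%:E = \int[mu]_(x in `]a, b[) c%:E)%E.
  rewrite integral_cst//= lebesgue_measure_itv/= lte_fin.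
  move: ab; rewrite le_eqVlt => /orP[/eqP->|ab]; last by rewrite ab -EFinB -EFinM.
  by rewrite ltxx subrr mulr0 mule0.
apply: ge0_le_integral => //.
by move=> x _; rewrite lee_fin density_ge0.
Qed.

Lemma eta_null (A : set (measurableTypeR R)) : measurable A -> mu A = 0%E -> eta A = 0%E.
Proof. by move=> mA A0; rewrite eta_density//; apply: null_set_integral. Qed.

(** The domain of the potential is not a single point, which would have mass 0. *)
Lemma edom_neq (x : R) : exists2 z : R, z != x & edom V z.
Proof.
apply: contrapT => H.
have f0 z : z != x -> f z = 0.
  by move=> zx; apply: density_out => dz; apply: H; exists z.
have : eta setT = 0%E.
  have E1 : eta [set x] = 0%E by apply: eta_null => //; exact: lebesgue_measure_set1.
  have E2 : eta (~` [set x]) = 0%E.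
    rewrite eta_density; last exact: measurableC.
    by rewrite integral0_eq// => z /eqP zx; rewrite f0.
  have -> : setT = [set x] `|` ~` [set x] by rewrite setUv.
  rewrite (@measureU _ _ _ eta)//; [|exact: measurableC|by rewrite setICr].
  by rewrite [X in (X + _)%E]E1 [X in (_ + X)%E]E2 adde0.
by rewrite probability_setT => -[] /eqP; rewrite oner_eq0.
Qed.

Hypothesis eta_sym : symmetric_measure eta.

Lemma eta_itvN (a b : R) : eta `]a, b[%classic = eta `]- b, - a[%classic.
Proof.
rewrite eta_sym//; congr (eta _); apply/seteqP; split=> [_ [x + <-]|x].
- by rewrite /= !in_itv/= !ltrN2 andbC.
- rewrite /= !in_itv/= => /andP[h1 h2]; exists (- x); last by rewrite opprK.
  by rewrite /= in_itv/= ltrNr h2 ltrNl h1.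
Qed.

(** Symmetry of the measure only says that the densities at [x] and [- x] agree almost
    everywhere.  If [V x < c < c' < V (- x)], then [V < c] on a short segment from
    [x] towards another point [z] of the domain, by convexity, and [V > c'] on the
    reflected segment, by lower semicontinuity; so the two segments have different
    masses. *)
Lemma potential_even_le x : (V (- x) <= V x)%E.
Proof.
rewrite leNgt; apply/negP => Vx.
have dx : edom V x by apply: lt_le_trans Vx _; exact: leey.
pose r := v x; have Vr : V x = r%:E by rewrite (edomE VNy dx).
have [c [c' [rc cc Vc]]] : exists c c' : R, [/\ r < c, c < c' & (c'%:E < V (- x))%E].
  move: Vx; rewrite Vr; case: (V (- x)) => [s| |] //.
  - rewrite lte_fin => rs; exists (r + (s - r) / 3), (r + (s - r) / 2).
    by rewrite lte_fin; split; lra.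
  - by move=> _; exists (r + 1), (r + 2); rewrite ltry; split=> //; lra.
have [z zx dz] := edom_neq x.
pose w := v z; have Vw : V z = w%:E by rewrite (edomE VNy dz).
have [W Wx VW] := Vlsc Vc.
have [e /= e0 eW] := (@nbhs_ballP R R^o (- x) W).1 Wx.
have zx0 : 0 < `|z - x| by rewrite normr_gt0 subr_eq0.
(* fraction of the way from x to z: within e of x, and V still below c *)
pose t := Num.min 1 (Num.min (e / `|z - x|) ((c - r) / (`|w - r| + 1))).
have w0 : 0 < `|w - r| + 1 by rewrite ltr_wpDl.
have t0 : 0 < t by rewrite !lt_min ltr01 !divr_gt0// subr_gt0.
have t1 : t <= 1 by rewrite ge_min lexx.
have te : t * `|z - x| <= e by rewrite -ler_pdivlMr// !ge_min lexx !orbT.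
have tw : t * (`|w - r| + 1) <= c - r by rewrite -ler_pdivlMr// !ge_min lexx !orbT.
pose y := x + t * (z - x).
pose a : R := Num.min x y; pose b : R := Num.max x y.
have ba : b - a = t * `|z - x|.
  have yx : y - x = t * (z - x) by rewrite /y; ring.
  rewrite /a /b; have [xy|xy] := leP x y.
    by rewrite yx ger0_norm//; move: xy; rewrite -[x <= y]subr_ge0 yx pmulr_rge0.
  rewrite ltr0_norm; first by rewrite /y; ring.
  by move: xy; rewrite -[y < x]subr_lt0 yx pmulr_rlt0.
have ab : a < b by rewrite -subr_gt0 ba mulr_gt0.
have param (s : R) : a < s < b -> exists2 k, 0 < k < t & s = x + k * (z - x).
  move=> /andP[sa sb]; exists ((s - x) / (z - x)); last by field; rewrite subr_eq0.
  have [zx'|xz] := ltP z x.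
    have yx : y < x by rewrite /y; nra.
    move: sa sb; rewrite /a /b (min_idPr _) ?ltW// (max_idPl _) ?ltW// => sa sb.
    have -> : (s - x) / (z - x) = (x - s) / (x - z) by rewrite -(opprB x s) -(opprB x z) invrN mulrNN.
    rewrite divr_gt0 ?subr_gt0//= ltr_pdivrMr ?subr_gt0//.
    by move: sa; rewrite /y; lra.
  have {}xz : x < z by rewrite lt_neqAle xz andbT eq_sym.
  have xy : x < y by rewrite /y; nra.
  move: sa sb; rewrite /a /b (min_idPl _) ?ltW// (max_idPr _) ?ltW// => sa sb.
  rewrite divr_gt0 ?subr_gt0//= ltr_pdivrMr ?subr_gt0//.
  by move: sb; rewrite /y; lra.
have lo (s : R) : a < s < b -> expR (- c) <= f s.
  move=> /param[k /andP[k0 kt] ->].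
  have k01 : 0 <= k <= 1 by apply/andP; split; lra.
  have [] := fine_conv VNy Vconv dz dx k01.
  have -> : k * z + (1 - k) * x = x + k * (z - x) by ring.
  move=> ds vs; rewrite density_gt0E// ler_expR lerN2 (le_trans vs)//.
  rewrite -/r -/w.
  have : k * (w - r) <= t * (`|w - r| + 1).
    apply: (@le_trans _ _ (k * (`|w - r| + 1))); last by rewrite ler_pM2r// ltW.
    rewrite ler_pM2l//; have := ler_norm (w - r); lra.
  lra.
have hi (s : R) : - b < s < - a -> f s <= expR (- c').
  move=> /andP[s1 s2].
  have : a < - s < b by apply/andP; split; lra.
  move=> /param[k /andP[k0 kt] sk].
  have Ws : W s.
    apply: eW; rewrite /ball/=.
    have -> : - x - s = k * (z - x) by rewrite -[s]opprK sk; ring.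
    by rewrite normrM gtr0_norm// (lt_le_trans _ te)// ltr_pM2r.
  have := VW _ Ws; have [ds|nds] := pselect (edom V s); last by rewrite density_out// expR_ge0.
  by rewrite (edomE VNy ds) lte_fin density_gt0E// ler_expR lerN2 => /ltW.
have := eta_itv_ge (ltW ab) lo (expR_ge0 _).
rewrite eta_itvN => h1.
have := eta_itv_le _ hi (expR_ge0 _); rewrite lerN2 => /(_ (ltW ab)) h2.
have := le_trans h1 h2; rewrite lee_fin opprK [- a + b]addrC ler_pM2r ?subr_gt0// ler_expR.
lra.
Qed.

Lemma potential_even x : V (- x) = V x.
Proof.
apply/eqP; rewrite eq_le potential_even_le/=.
by rewrite -{1}(opprK x) potential_even_le.
Qed.

End LogConcave.

(** * Tails *)
Section Tail.
Context {R : realType}.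
Notation mu := (@lebesgue_measure R).
Variables (eta : probability (measurableTypeR R) R) (V : R -> \bar R).
Hypothesis etaV : log_concave_with eta V.
Hypothesis eta_sym : symmetric_measure eta.

Local Notation v := (fine \o V).
Local Notation f := (density V).

Let VNy : forall x, (V x != -oo)%E. Proof. by have [[]] := etaV. Qed.
Let Vconv : econvex_function V. Proof. by have [[]] := etaV. Qed.
Let Vlsc : lower_semicontinuous V. Proof. by have [[]] := etaV. Qed.
Let Vsym : forall x, V (- x) = V x. Proof. exact: potential_even etaV eta_sym. Qed.
Let mfE A : measurable_fun A (fun x : measurableTypeR R => (f x)%:E).
Proof. by apply/measurable_EFinP; apply: measurable_funS (measurable_density etaV). Qed.

Lemma density_even_le (x y : R) : `|x| <= `|y| -> f y <= f x.
Proof.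
move=> xy; have [dy|ndy] := pselect (edom V y); last first.
  by rewrite (density_out ndy) density_ge0.
have dx := edom_le Vconv Vsym xy dy.
rewrite !(density_gt0E etaV)// ler_expR lerN2.
exact: (fine_even_le VNy Vconv Vsym).
Qed.

Lemma edom_pos : exists2 x : R, 0 < x & edom V x.
Proof.
have [z z0 dz] := edom_neq etaV 0.
exists `|z|; first by rewrite normr_gt0.
by apply: (edom_le Vconv Vsym) dz; rewrite normr_id.
Qed.

Lemma density0_gt0 : 0 < f 0.
Proof.
have [x x0 dx] := edom_pos; apply/(density_gt0 etaV).
by apply: (edom_le Vconv Vsym) dx; rewrite normr0.
Qed.

Definition tail (x : R) : R := fine (eta `]x, +oo[%classic).

Lemma tailE x : (eta `]x, +oo[%classic = (tail x)%:E)%E.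
Proof. by rewrite fineK// fin_num_measure. Qed.

Lemma tail_split (x y : R) : x <= y ->
  ((tail x - tail y)%:E = \int[mu]_(s in `]x, y]) (f s)%:E)%E.
Proof.
move=> xy; rewrite EFinB -!tailE.
have -> : `]x, +oo[%classic = `]x, y] `|` `]y, +oo[ by rewrite -itv_bndbnd_setU.
rewrite (@measureU _ _ _ eta)//; last first.
  apply/seteqP; split => // z []; rewrite /= !in_itv/= andbT => /andP[_ zy].
  by rewrite ltNge zy.
rewrite -(eta_density etaV)//.
by rewrite addeK// fin_num_measure.
Qed.

Lemma tail_ge0 x : 0 <= tail x. Proof. exact: fine_ge0. Qed.

Lemma tail_nonincreasing (x y : R) : x <= y -> tail y <= tail x.
Proof.
move=> xy; rewrite -subr_ge0 -lee_fin (tail_split xy).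
by apply: integral_ge0 => s _; rewrite lee_fin density_ge0.
Qed.

Lemma tail_diff_bounds (x y : R) : 0 <= x -> x <= y ->
  f y * (y - x) <= tail x - tail y <= f x * (y - x).
Proof.
move=> x0 xy; rewrite -!lee_fin (tail_split xy).
have len c : ((c * (y - x))%:E = \int[mu]_(s in `]x, y]) c%:E)%E.
  rewrite integral_cst//= lebesgue_measure_itv/= lte_fin.
  move: xy; rewrite le_eqVlt => /orP[/eqP->|->]; last by rewrite -EFinB -EFinM.
  by rewrite ltxx subrr mulr0 mule0.
rewrite !len; apply/andP; split; apply: ge0_le_integral => //.
- by move=> s _; rewrite lee_fin density_ge0.
- move=> s; rewrite /= in_itv/= => /andP[xs sy]; rewrite lee_fin density_even_le//.
  by rewrite !ger0_norm//; lra.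
- by move=> s _; rewrite lee_fin density_ge0.
- move=> s; rewrite /= in_itv/= => /andP[xs sy]; rewrite lee_fin density_even_le//.
  by rewrite !ger0_norm//; lra.
Qed.

Lemma tail0 : tail 0 = 2^-1.
Proof.
have h1 : eta `]-oo, 0%R[%classic = eta `]0%R, +oo[%classic.
  rewrite eta_sym//; congr (eta _); apply/seteqP; split=> [_ [x + <-]|x].
  - by rewrite /= !in_itv/= andbT oppr_gt0.
  - by rewrite /= !in_itv/= andbT => x0; exists (- x); rewrite ?opprK// /= in_itv/= oppr_lt0.
have h0 : eta [set 0] = 0%E by apply: (eta_null etaV) => //; exact: lebesgue_measure_set1.
have : (eta setT = eta `]-oo, 0%R[%classic + (eta [set 0%R] + eta `]0%R, +oo[%classic))%E.
  have e1 : [set: R] = `]-oo, 0[%classic `|` ([set 0] `|` `]0, +oo[%classic).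
    apply/seteqP; split => // x _; rewrite /= !in_itv/= andbT.
    by have [x0|x0|x0] := ltgtP x 0; [left|right; right|right; left].
  rewrite {1}e1 (@measureU _ _ _ eta)//.
  - rewrite (@measureU _ _ _ eta)//.
    by apply/seteqP; split => // x [/= ->]; rewrite in_itv/= ltxx.
  - exact: measurableU.
  - apply/seteqP; split => // x [] /=; rewrite !in_itv/= andbT => x0 [] h.
      by rewrite h ltxx in x0.
    by have := lt_trans x0 h; rewrite ltxx.
rewrite probability_setT h1 [X in (_ + (X + _))%E]h0 add0e tailE -EFinD => -[].
lra.
Qed.

Lemma tail_vanishes (e : R) : 0 < e -> exists2 x : R, 0 <= x & tail x < e.
Proof.
move=> e0; apply: contrapT => H.
have He x : 0 <= x -> e <= tail x.
  by move=> x0; rewrite leNgt; apply/negP => h; apply: H; exists x.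
pose F n : set (measurableTypeR R) := `]n%:R, +oo[%classic.
have F0 : \bigcap_n F n = set0.
  rewrite -subset0 => x h.
  have := h (Num.bound `|x|) Logic.I; rewrite /F/= in_itv/= andbT.
  have := archi_boundP (normr_ge0 x); have := ler_norm x; lra.
have : eta (F n) @[n --> \oo] --> eta (\bigcap_n F n).
  apply: nonincreasing_cvg_mu.
  - by rewrite ltey_eq fin_num_measure//; exact: measurable_itv.
  - by move=> n; exact: measurable_itv.
  - by rewrite F0; exact: measurable0.
  - move=> m n mn; apply/subsetPset => x; rewrite /F/= !in_itv/= !andbT.
    by apply: le_lt_trans; rewrite ler_nat.
rewrite F0 measure0 => /cvg_lim l0.
have : (e%:E <= limn (fun n => eta (F n)))%E.
  apply: lime_ge.
    apply: ereal_nonincreasing_is_cvgn; apply/nonincreasing_seqP => n.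
    rewrite /F !tailE lee_fin tail_nonincreasing// ler_nat//.
  by apply: nearW => n; rewrite /F tailE lee_fin He.
by rewrite l0// lee_fin leNgt e0.
Qed.

Hypothesis eta_cont : essentially_continuous eta V.

(** The profile vanishes at 0 because arbitrarily small positive values of the density
    are attained.  If the density is positive everywhere this follows from
    integrability.  Otherwise the right endpoint [a] of the domain is on the
    boundary of the support, so essential continuity makes [V] infinite at [a], and
    by lower semicontinuity [V] is large just before [a]. *)
Lemma density_small (e : R) : 0 < e -> exists2 x : R, 0 < x & 0 < f x < e.
Proof.
move=> e0.
have [[x1 nx1]|alld] := pselect (exists x1, ~ edom V x1); last first.
  apply: contrapT => H.
  have fe x : 0 < x -> e <= f x.
    move=> x0; rewrite leNgt; apply/negP => h; apply: H; exists x => //.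
    rewrite h andbT; apply/(density_gt0 etaV); apply: contrapT => nd.
    by apply: alld; exists x.
  have /andP[_] := tail_diff_bounds (lexx 0) (ltW (divr_gt0 ltr01 e0)).
  have /andP[h _] := tail_diff_bounds (lexx 0) (ltW (divr_gt0 ltr01 e0)).
  have := tail_ge0 (1 / e); have := fe _ (divr_gt0 ltr01 e0); move: h.
  rewrite tail0 subr0 => h h1 h2 _.
  have : e * (1 / e) <= f (1 / e) * (1 / e) by rewrite ler_wpM2r// divr_ge0// ltW.
  by rewrite mul1r divff ?gt_eqF//; rewrite mul1r in h h1 h2; lra.
pose S := [set x : R | 0 <= x /\ edom V x].
pose a := sup S.
have [x2 x20 dx2] := edom_pos.
have S0 : S !=set0 by exists x2; split => //; exact: ltW.
have Sub : has_ubound S.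
  exists `|x1| => x [x0 dx]; rewrite leNgt; apply/negP => h; apply: nx1.
  by apply: (edom_le Vconv Vsym) dx; rewrite [leRHS]ger0_norm// ltW.
have x2a : x2 <= a by apply: ub_le_sup => //; split => //; exact: ltW.
have a0 : 0 < a by exact: lt_le_trans x2a.
have beyond x : a < x -> ~ edom V x.
  move=> ax dx; have : x <= a.
    by apply: ub_le_sup => //; split => //; rewrite ltW// (lt_trans a0).
  by rewrite leNgt ax.
have below x : x < a -> exists2 y, x < y & 0 <= y /\ edom V y.
  move=> xa; have [y [y0 dy]] := sup_adherent (eps := a - x) (ltac:(by rewrite subr_gt0)) (conj S0 Sub).
  by rewrite subKr => xy; exists y.
have Va : V a = +oo%E.
  suff /eta_cont : boundary (measure_support eta) a.
    rewrite (densityE etaV) => -[fa]; apply/eqP; rewrite -leye_eq leNgt; apply/negP => da.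
    by have := (density_gt0 etaV a).2 da; rewrite fa ltxx.
  split.
    apply: subset_closure => U oU Ua.
    have /nbhs_ballP[r /= r0 rU] : nbhs a U by exact: open_nbhs_nbhs.
    pose b := Num.max (a - r) 0.
    have ba : b < a by rewrite gt_max a0 ltrBlDr ltrDl r0.
    have b0 : 0 <= b by rewrite le_max lexx orbT.
    have [y by_ [y0 dy]] := below _ ba.
    have ya : y <= a by rewrite leNgt; apply/negP => /beyond; exact.
    have sub : `]b, y[%classic `<=` U.
      move=> z /=; rewrite in_itv/= => /andP[bz zy]; apply: rU; rewrite /ball/=.
      rewrite gtr0_norm ?subr_gt0 ?(lt_le_trans zy)//.
      have : a - r <= b by rewrite le_max lexx.
      lra.
    have fb z : b < z < y -> f y <= f z.
      move=> /andP[bz zy]; apply: density_even_le.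
      by rewrite !ger0_norm ?(ltW zy)// (le_trans b0 (ltW bz)).
    have : (0 < eta `]b, y[%classic)%E.
      apply: lt_le_trans (eta_itv_ge etaV (ltW by_) fb (density_ge0 V y)).
      by rewrite lte_fin mulr_gt0 ?subr_gt0//; apply/(density_gt0 etaV).
    move=> /lt_le_trans; apply; apply: le_measure; rewrite ?inE//.
    exact: open_measurable.
  rewrite /interior => /nbhs_ballP[r /= r0 rS].
  have Sy : measure_support eta (a + r / 2).
    apply: rS; rewrite /ball/= opprD addrA subrr sub0r normrN gtr0_norm ?divr_gt0//.
    by rewrite ltr_pdivrMr//; lra.
  have := Sy [set x | a < x] (open_gt (y := a)).
  rewrite /= ltrDl divr_gt0// => /(_ isT).
  rewrite -set_itvoy (eta_density etaV)// integral0_eq ?ltxx// => z /=.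
  by rewrite in_itv/= andbT => /beyond /density_out ->.
have ca : ((- ln e)%:E < V a)%E by rewrite Va ltry.
have [W Wa VW] := Vlsc ca.
have /nbhs_ballP[r /= r0 rW] := Wa.
pose b := Num.max (a - r) 0.
have ba : b < a by rewrite gt_max a0 ltrBlDr ltrDl r0.
have b0 : 0 <= b by rewrite le_max lexx orbT.
have [y by_ [y0 dy]] := below _ ba.
have yN : y != a.
  by apply/eqP => ya; move: dy; rewrite ya /edom/= Va ltxx.
have ya : y < a.
  by rewrite lt_neqAle yN leNgt; apply/negP => /beyond; exact.
exists y; first exact: le_lt_trans by_.
apply/andP; split; first exact/(density_gt0 etaV).
have : W y.
  apply: rW; rewrite /ball/= gtr0_norm ?subr_gt0//.
  have : a - r <= b by rewrite le_max lexx.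
  lra.
move=> /VW; rewrite (edomE VNy dy) lte_fin (density_gt0E etaV)// => h.
by rewrite -[ltRHS]lnK ?posrE// ltr_expR ltrNl.
Qed.

(** Some positive value of the density is smaller than [f x], and it can only be
    attained beyond [x]. *)
Lemma edom_open (x : R) : 0 <= x -> edom V x -> exists2 y : R, x < y & edom V y.
Proof.
move=> x0 dx; have fx := (density_gt0 etaV x).2 dx.
have [y y0 /andP[fy fyx]] := density_small fx.
exists y; last exact/(density_gt0 etaV).
rewrite ltNge; apply/negP => yx.
have := @density_even_le y x; rewrite (gtr0_norm y0) (ger0_norm x0) => /(_ yx).
by rewrite leNgt fyx.
Qed.

Lemma tail_gt0 (x : R) : 0 <= x -> edom V x -> 0 < tail x.
Proof.
move=> x0 dx; have [y xy dy] := edom_open x0 dx.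
have /andP[h _] := tail_diff_bounds x0 (ltW xy).
have : 0 < f y * (y - x) by rewrite mulr_gt0 ?subr_gt0//; apply/(density_gt0 etaV).
by have := tail_ge0 y; lra.
Qed.

Lemma tail_out (x : R) : 0 <= x -> ~ edom V x -> tail x = 0.
Proof.
move=> x0 nx; rewrite /tail (eta_density etaV)// integral0_eq// => z /=.
rewrite in_itv/= andbT => xz; congr EFin; apply: density_out => dz; apply: nx.
by apply: (edom_le Vconv Vsym) dz; rewrite !ger0_norm ?(ltW xz)// (le_trans x0 (ltW xz)).
Qed.

End Tail.

(** * The tail quantile *)
Section Quantile.
Context {R : realType}.
Notation mu := (@lebesgue_measure R).
Variables (eta : probability (measurableTypeR R) R) (V : R -> \bar R).
Hypothesis etaV : log_concave_with eta V.
Hypothesis eta_sym : symmetric_measure eta.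

Local Notation f := (density V).
Local Notation G := (tail eta).
Local Notation half := (@half_unit R).

Definition tail_quantile (t : R) : R := inf [set x | 0 <= x /\ G x <= t].
Local Notation q := tail_quantile.

(** The Galois connection between the tail and its generalized inverse; continuity
    of the tail makes the infimum attained. *)
Lemma tail_quantile_le (t x : R) : 0 < t -> 0 <= x -> (q t <= x) = (G x <= t).
Proof.
move=> t0 x0.
have Slb : has_lbound [set x | 0 <= x /\ G x <= t] by exists 0 => y [].
apply/idP/idP => [qx|Gx]; last by apply: ge_inf.
have Sinf : has_inf [set x | 0 <= x /\ G x <= t].
  split=> //; have [y y0 Gy] := tail_vanishes etaV t0.
  by exists y; split=> //; exact: ltW.
have f0 := density0_gt0 etaV eta_sym.
apply/ler_addgt0Pl => e e0.
have [y [y0 Gy] yq] := inf_adherent (divr_gt0 e0 f0) Sinf.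
have [xy|yx] := leP x y; last first.
  have := tail_nonincreasing etaV (ltW yx); lra.
have /andP[_ h] := tail_diff_bounds etaV eta_sym x0 xy.
have fx : f x <= f 0.
  by apply: (density_even_le etaV eta_sym); rewrite normr0.
have h1 : f x * (y - x) <= f 0 * (y - x) by rewrite ler_wpM2r// subr_ge0.
have h2 : f 0 * (y - x) <= e.
  by rewrite mulrC -ler_pdivlMr//; move: yq; rewrite -/(q t); lra.
lra.
Qed.

Lemma tail_quantile_gt (t x : R) : 0 < t -> 0 <= x -> (x < q t) = (t < G x).
Proof. by move=> t0 x0; rewrite !ltNge tail_quantile_le. Qed.

Lemma tail_quantile_gt0 (t : R) : 0 < t < 2^-1 -> 0 < q t.
Proof. by move=> /andP[t0 t2]; rewrite tail_quantile_gt// (tail0 etaV). Qed.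

Lemma tail_quantileK (t : R) : 0 < t < 2^-1 -> G (q t) = t.
Proof.
move=> th; have /andP[t0 t2] := th; have q0 := tail_quantile_gt0 th.
apply/eqP; rewrite eq_le -tail_quantile_le ?(ltW q0)// lexx/=.
have f0 := density0_gt0 etaV eta_sym.
apply/ler_addgt0Pl => e e0.
pose y := Num.max 0 (q t - e / f 0).
have y0 : 0 <= y by rewrite le_max lexx.
have yq : y < q t by rewrite gt_max q0 ltrBlDr ltrDl divr_gt0.
have : t < G y by rewrite -tail_quantile_gt.
have /andP[_ h] := tail_diff_bounds etaV eta_sym y0 (ltW yq).
have fx : f y <= f 0.
  by apply: (density_even_le etaV eta_sym); rewrite normr0.
have h1 : f y * (q t - y) <= f 0 * (q t - y) by rewrite ler_wpM2r// subr_ge0 ltW.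
have h2 : f 0 * (q t - y) <= e.
  rewrite mulrC -ler_pdivlMr//.
  have : q t - e / f 0 <= y by rewrite le_max lexx orbT.
  lra.
lra.
Qed.

Lemma tail_quantile_edom (t : R) : 0 < t < 2^-1 -> edom V (q t).
Proof.
move=> th; apply: contrapT => /(tail_out etaV eta_sym (ltW (tail_quantile_gt0 th))).
by rewrite tail_quantileK// => t0; move: th; rewrite t0 ltxx.
Qed.

Lemma tail_quantile_decreasing (s t : R) : 0 < s -> s < t -> t < 2^-1 -> q t < q s.
Proof.
move=> s0 st t2; have t0 := lt_trans s0 st.
have th : 0 < t < 2^-1 by rewrite t0.
by rewrite tail_quantile_gt ?(ltW (tail_quantile_gt0 th))// tail_quantileK.
Qed.

Lemma measurable_tail_quantile : measurable_fun half q.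
Proof.
apply: antitone_measurable; first exact: interval_is_interval.
move=> s t; rewrite !half_unitP => /andP[s0 _] /andP[_ t2].
by rewrite le_eqVlt => /orP[/eqP -> //|st]; apply/ltW/tail_quantile_decreasing.
Qed.

Lemma tail_le_half x : 0 <= x -> G x <= 2^-1.
Proof. by move=> x0; rewrite -(tail0 etaV eta_sym); exact: (tail_nonincreasing etaV). Qed.

Local Open Scope ereal_scope.

(** The quantile transform.  Both sides are finite measures of [A], so it suffices to
    compare them on rays, where the Galois connection applies. *)
Lemma positive_part_law (A : set (measurableTypeR R)) : measurable A ->
  eta (A `&` `]0%R, +oo[) = mu (half `&` q @^-1` A).
Proof.
move=> mA.
have mP : measurable (`]0%R, +oo[%classic : set (measurableTypeR R)) by exact: measurable_itv.
pose qp : measurableTypeR R -> measurableTypeR R := q \_ half.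
have mqp : measurable_fun setT qp.
  apply/(measurable_restrictT _ (measurable_half_unit (R := R))).
  exact: measurable_tail_quantile.
pose m1 : {measure set (measurableTypeR R) -> \bar R} := mrestr eta mP.
pose m : {measure set (measurableTypeR R) -> \bar R} :=
  mrestr mu (measurable_half_unit (R := R)).
have [m2 m2E] := pushforward_measure m mqp.
have m2P B : m2 B = mu (half `&` q @^-1` B).
  rewrite m2E /pushforward /m /= /mrestr; congr (mu _).
  have qpE t : half t -> qp t = q t by move=> /mem_set ht; rewrite /qp patchE ht.
  apply/seteqP; split => t /=.
  - by move=> [+ ht]; rewrite qpE.
  - by move=> [ht]; rewrite qpE.
rewrite -m2P -[LHS]/(m1 A).
apply: (@measure_unique _ R (measurableTypeR R) (@RGenOInfty.G R) (fun n => `](- n%:R)%R, +oo[%classic) _ _ _ _ m1 m2) => //.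
- exact: RGenOInfty.measurableE.
- move=> _ _ [x ->] [y ->]; exists (Num.max x y).
  by apply/seteqP; split => z; rewrite /= !in_itv/= !andbT gt_max => /andP.
- by move=> n; exists (- n%:R)%R.
- apply/seteqP; split => // x _; exists (Num.bound `|x|%R) => //.
  rewrite /= in_itv/= andbT ltrNl.
  have := archi_boundP (normr_ge0 x); have := ler_norm (- x)%R; rewrite normrN; lra.
- move=> _ [x ->]; rewrite m2P /m1 /= /mrestr.
  have [x0|x0] := leP 0%R x.
    have -> : `]x, +oo[ `&` `]0%R, +oo[ = `]x, +oo[%classic.
      by apply/setIidPl => z; rewrite /= !in_itv/= !andbT; exact: le_lt_trans.
    rewrite tailE; have -> : half `&` q @^-1` `]x, +oo[ = `]0%R, G x[%classic.
      apply/seteqP; split => t; rewrite /= half_unitP !in_itv/= ?andbT.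
        by move=> [/andP[t0 t2]]; rewrite tail_quantile_gt// t0.
      move=> /andP[t0 tG]; rewrite tail_quantile_gt// t0; split=> //.
      by rewrite (lt_le_trans tG)// tail_le_half.
    rewrite lebesgue_measure_itv/= lte_fin; case: ltP => [_|]; first by rewrite sube0.
    by move=> h; congr EFin; apply/eqP; rewrite eq_le h tail_ge0.
  have -> : `]x, +oo[ `&` `]0%R, +oo[ = `]0%R, +oo[%classic.
    by apply/setIidPr => z; rewrite /= !in_itv/= !andbT; exact: lt_trans.
  have -> : half `&` q @^-1` `]x, +oo[ = half.
    apply/setIidPl => t; rewrite half_unitP /= in_itv/= andbT => th.
    exact: lt_trans x0 (tail_quantile_gt0 th).
  by rewrite tailE (tail0 etaV eta_sym) half_unit_length.
- move=> n; rewrite /m1 /= /mrestr ltey_eq fin_num_measure//.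
  by apply: measurableI => //; exact: measurable_itv.
Qed.

Lemma eta_sym_law : sym_law eta q.
Proof.
move=> A mA.
have mP : measurable (`]0%R, +oo[%classic : set (measurableTypeR R)) by exact: measurable_itv.
have mN : measurable (`]-oo, 0%R[%classic : set (measurableTypeR R)) by exact: measurable_itv.
have mNA : measurable ((-%R @^-1` A) : set (measurableTypeR R)).
  rewrite -[X in measurable X]setTI.
  have := @oppr_measurable R setT; exact.
have -> : eta A = eta (A `&` `]0%R, +oo[) + eta (A `&` `]-oo, 0%R[).
  have e1 : A = (A `&` `]0%R, +oo[) `|` ((A `&` `]-oo, 0%R[) `|` (A `&` [set 0%R])).
    rewrite -!setIUr; apply/esym/setIidPl => x _; rewrite /= !in_itv/= andbT.
    by have [x0|x0|x0] := ltgtP x 0%R; [right; left|left|right; right].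
  have mI B : measurable B -> measurable (A `&` B) by exact: measurableI.
  rewrite {1}e1 (@measureU _ _ _ eta).
  - congr (_ + _); rewrite (@measureU _ _ _ eta).
    + rewrite [X in _ + X](eta_null etaV) ?adde0//; first exact: mI.
      apply/eqP; rewrite eq_le measure_ge0 andbT.
      by rewrite -(lebesgue_measure_set1 (0%R : R)) le_measure// ?inE//; exact: mI.
    + exact: mI.
    + exact: mI.
    + apply/seteqP; split => // x [[_ h] [_ /= x0]].
      by move: h; rewrite x0 /= in_itv/= ltxx.
  - exact: mI.
  - by apply: measurableU; exact: mI.
  - apply/seteqP; split => // x [[_ x0] [] [_]].
    + by move: x0; rewrite /= !in_itv/= andbT => x0 /(lt_trans x0); rewrite ltxx.
    + by move=> /= h; move: x0; rewrite h /= in_itv/= ltxx.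
rewrite positive_part_law//; congr (_ + _).
have -> : eta (A `&` `]-oo, 0%R[) = eta ((-%R @^-1` A) `&` `]0%R, +oo[).
  rewrite eta_sym; last exact: measurableI.
  congr (eta _); apply/seteqP; split => [_ [x [Ax +] <-]|x [Ax +]].
  - by rewrite /= !in_itv/= andbT opprK oppr_gt0.
  - by rewrite /= in_itv/= andbT => x0; exists (- x)%R; rewrite ?opprK// in_itv/= oppr_lt0.
exact: positive_part_law.
Qed.

End Quantile.

(** * The profile of a moment measure *)
Section MomentProfile.
Context {R : realType}.
Notation mu := (@lebesgue_measure R).

(** The inequality [1 + z <= expR z] for [z = m * (t - s)] and for its opposite. *)
Lemma supergradient_expR (m x b : R) : 0 <= m ->
  supergradient b (fun s => - expR (- m * (s - x))) (fun s => m * expR (- m * (s - x))).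
Proof.
move=> m0 s t s0 st tb.
have Es : expR (- m * (s - x)) = expR (- m * (t - x)) * expR (m * (t - s)).
  by rewrite -expRD; congr expR; ring.
have Et : expR (- m * (t - x)) = expR (- m * (s - x)) * expR (- m * (t - s)).
  by rewrite -expRD; congr expR; ring.
have h1 := expR_ge1Dx (m * (t - s)); have h2 := expR_ge1Dx (- m * (t - s)).
have p1 := expR_gt0 (- m * (s - x)); have p2 := expR_gt0 (- m * (t - x)).
apply/andP; split.
- have : expR (- m * (t - x)) * (1 + m * (t - s)) <= expR (- m * (s - x)).
    by rewrite Es ler_pM2l.
  lra.
- have : expR (- m * (s - x)) * (1 + - m * (t - s)) <= expR (- m * (t - x)).
    by rewrite [leRHS]Et ler_pM2l.
  lra.
Qed.

Lemma integral_expR_slope (m x y : R) : 0 <= m -> 0 < x -> x < y ->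
  (\int[mu]_(s in `]x, y]) (m * expR (- m * (s - x)))%:E = (1 - expR (- m * (y - x)))%:E)%E.
Proof.
move=> m0 x0 xy.
have y1 : y < y + 1 by rewrite ltrDl.
rewrite (integral_supergradient (@supergradient_expR m x (y + 1) m0) _ x0 xy y1); last first.
  by move=> s _; rewrite mulr_ge0// expR_ge0.
by rewrite subrr mulr0 expR0 opprK addrC.
Qed.

Variables (eta : probability (measurableTypeR R) R) (V : R -> \bar R).
Hypothesis etaV : log_concave_with eta V.
Hypothesis eta_sym : symmetric_measure eta.
Hypothesis eta_cont : essentially_continuous eta V.

Local Notation v := (fine \o V).
Local Notation f := (density V).
Local Notation G := (tail eta).
Local Notation q := (tail_quantile eta).
Local Notation D := (right_slope V).
Local Notation half := (@half_unit R).

Let VNy : forall x, (V x != -oo)%E. Proof. by have [[]] := etaV. Qed.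
Let Vconv : econvex_function V. Proof. by have [[]] := etaV. Qed.
Let Vsym : forall x, V (- x) = V x. Proof. exact: potential_even etaV eta_sym. Qed.
Let dopen : forall x : R, 0 <= x -> edom V x -> exists2 y : R, x < y & edom V y.
Proof. exact: edom_open etaV eta_sym eta_cont. Qed.
Let mfE A : measurable_fun A (fun x : measurableTypeR R => (f x)%:E).
Proof. by apply/measurable_EFinP; apply: measurable_funS (measurable_density etaV). Qed.

Let mexp (c m x : R) A : measurable_fun A (fun s : measurableTypeR R => (c * (m * expR (- m * (s - x))))%:E).
Proof.
apply/measurable_EFinP; apply: measurable_funS (_ : measurable_fun setT _) => //.
apply: measurable_funM => //; apply: measurable_funM => //.
apply: measurableT_comp => //; apply: measurable_funM => //.
exact: measurable_funB.
Qed.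

(** Concavity of the profile.  Below, [f s] is compared with the exponential through
    [f x] of rate [D x], which dominates [f] beyond [x]; above, with the exponential
    interpolating [f] at [x] and [y], which [f] dominates in between.  For an
    exponential of rate [m] the decrease is exactly [m] times the integral. *)
Lemma density_tail_slope (x y : R) : 0 < x -> x < y -> edom V y ->
  D x * (G x - G y) <= f x - f y <= D y * (G x - G y).
Proof.
move=> x0 xy dy; have y0 := lt_trans x0 xy.
have dx : edom V x by apply: (edom_le Vconv Vsym) dy; rewrite !ger0_norm ltW.
have D0 : 0 <= D x by apply: (right_slope_ge0 VNy Vconv Vsym (ltW x0)); exact: dopen (ltW x0) dx.
have din s : x < s -> s <= y -> edom V s.
  by move=> xs sy; apply: (edom_le Vconv Vsym) dy; rewrite !ger0_norm ?(ltW y0)// ltW// (lt_trans x0).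
have fxy : f y = f x * expR (v x - v y).
  by rewrite !(density_gt0E etaV)// -expRD; congr expR; ring.
have fx0 := density_ge0 V x.
have comp (m : R) : 0 <= m ->
    ((m * (G x - G y))%:E = \int[mu]_(s in `]x, y]) (m * f s)%:E)%E.
  move=> m0; rewrite EFinM (tail_split etaV (ltW xy)) -ge0_integralZl_EFin//.
  by move=> s _; rewrite lee_fin density_ge0.
have compE (m : R) : 0 <= m ->
    ((f x * (1 - expR (- m * (y - x))))%:E =
     \int[mu]_(s in `]x, y]) (f x * (m * expR (- m * (s - x))))%:E)%E.
  move=> m0; rewrite EFinM -(integral_expR_slope m0 x0 xy) -ge0_integralZl_EFin//.
    by move=> s _; rewrite lee_fin mulr_ge0// expR_ge0.
  have -> : (fun s => (m * expR (- m * (s - x)))%:E) =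
      (fun s => (1 * (m * expR (- m * (s - x))))%:E :> \bar R).
    by apply/funext => s; rewrite mul1r.
  exact: mexp.
have fs s : x < s -> s <= y -> f s = f x * expR (v x - v s).
  move=> xs sy; rewrite (density_gt0E etaV dx) (density_gt0E etaV (din s xs sy)).
  by rewrite -expRD; congr expR; ring.
apply/andP; split.
- apply: (@le_trans _ _ (f x * (1 - expR (- D x * (y - x))))).
    rewrite -lee_fin comp// compE//; apply: ge0_le_integral => //.
    + by move=> s _; rewrite lee_fin mulr_ge0// density_ge0.
    + by apply/measurable_EFinP; apply: measurable_funM => //; exact/measurable_EFinP.
    + move=> s; rewrite /= in_itv/= => /andP[xs sy].
      rewrite lee_fin mulrCA ler_wpM2l// fs// ler_wpM2l// ler_expR.
      have := right_slope_le VNy Vconv Vsym (ltW x0) xs (din s xs sy); lra.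
  rewrite mulrBr mulr1 lerB// fxy ler_wpM2l// ler_expR.
  have := right_slope_le VNy Vconv Vsym (ltW x0) xy dy; lra.
- pose m := (v y - v x) / (y - x).
  have yx0 : 0 < y - x by rewrite subr_gt0.
  have vxy : v x <= v y.
    by apply: (fine_even_le VNy Vconv Vsym) => //; rewrite !gtr0_norm// ltW.
  have m0 : 0 <= m by rewrite divr_ge0 ?subr_ge0// ltW.
  have mE : m * (y - x) = v y - v x by rewrite divfK// gt_eqF.
  have GG : 0 <= G x - G y by rewrite subr_ge0 (tail_nonincreasing etaV)// ltW.
  have mD : m <= D y.
    by rewrite ler_pdivrMr//; apply: (left_le_right_slope VNy Vconv (dopen (ltW y0) dy) xy dx).
  apply: (@le_trans _ _ (m * (G x - G y))); last by rewrite ler_wpM2r.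
  have -> : f x - f y = f x * (1 - expR (- m * (y - x))).
    by rewrite mulNr mE fxy opprB mulrBr mulr1.
  rewrite -lee_fin comp// compE//; apply: ge0_le_integral => //.
  + by move=> s _; rewrite lee_fin (mulr_ge0 fx0)// (mulr_ge0 m0)// expR_ge0.
  + by apply/measurable_EFinP; apply: measurable_funM => //; exact/measurable_EFinP.
  + move=> s; rewrite /= in_itv/= => /andP[xs sy].
    rewrite lee_fin (fs s xs sy) mulrCA; apply: (ler_wpM2l m0); apply: (ler_wpM2l fx0); rewrite ler_expR.
    move: sy; rewrite le_eqVlt => /orP[/eqP ->|sy]; first by rewrite mulNr mE; lra.
    have h := three_slopes VNy Vconv dx dy xs sy.
    have : (v s - v x) * (y - x) <= m * (s - x) * (y - x).
      by rewrite mulrAC mE; nra.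
    rewrite ler_pM2r// => h2; lra.
Qed.

Definition density_profile (t : R) : R := f (q t).
Definition slope_profile (t : R) : R := D (q t).

Lemma tail_quantile_right (t : R) : 0 < t < 2^-1 -> exists2 y : R, q t < y & edom V y.
Proof.
move=> th; apply: dopen; first exact/ltW/(tail_quantile_gt0 etaV).
exact: (tail_quantile_edom etaV).
Qed.

(** [q] is decreasing, so [s < t] corresponds to [q t < q s]. *)
Lemma moment_profile : profile density_profile slope_profile.
Proof.
split.
- move=> s t s0 st t2; have t0 := lt_trans s0 st; have s2 := lt_trans st t2.
  have th : 0 < t < 2^-1 by rewrite t0.
  have sh : 0 < s < 2^-1 by rewrite s0.
  have qq := tail_quantile_decreasing etaV eta_sym s0 st t2.
  have /andP[h1 h2] := density_tail_slope (tail_quantile_gt0 etaV eta_sym th) qq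
    (tail_quantile_edom etaV eta_sym sh).
  move: h1 h2; rewrite !(tail_quantileK etaV eta_sym)// => h1 h2.
  by apply/andP; split.

- move=> t th; apply: (right_slope_ge0 VNy Vconv Vsym).
    exact/ltW/(tail_quantile_gt0 etaV).
  exact: tail_quantile_right.
- by move=> t th; apply/(density_gt0 etaV); exact: (tail_quantile_edom etaV).
- move=> e e0; have [x x0 /andP[fx fe]] := density_small etaV eta_sym eta_cont e0.
  have dx := (density_gt0 etaV x).1 fx.
  exists (G x); first exact: (tail_gt0 etaV eta_sym eta_cont (ltW x0) dx).
  move=> t t0 tG t2; apply: le_trans (ltW fe).
  apply: (density_even_le etaV eta_sym).
  have th : 0 < t < 2^-1 by rewrite t0.
  have xq : x < q t by rewrite (tail_quantile_gt etaV)// ltW.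
  by rewrite !gtr0_norm// ?ltW// (lt_trans x0).
Qed.

End MomentProfile.

(** * Entropy and moment measure through the profile *)
Section Transfer.
Context {R : realType}.
Notation mu := (@lebesgue_measure R).

Lemma measure_eq_off_null d (T : measurableType d) (m : {measure set T -> \bar R})
    (X Y E : set T) : measurable X -> measurable Y -> measurable E ->
  m E = 0%E -> X `\` E = Y `\` E -> m X = m Y.
Proof.
move=> mX mY mE E0 XY.
have IE Z : measurable Z -> m (Z `&` E) = 0%E.
  move=> mZ; apply/eqP; rewrite eq_le measure_ge0 andbT -E0 le_measure ?inE//.
  exact: measurableI.
rewrite (measureDI m mX mE) (measureDI m mY mE) XY; congr (_ + _)%E.
by transitivity (0%E : \bar R); [exact: IE|exact/esym/IE].
Qed.

Lemma measurable_lne_fin d (T : measurableType d) (g : T -> \bar R) :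
  (forall x, g x \is a fin_num) -> measurable_fun setT g ->
  measurable_fun setT (fun x => lne (g x)).
Proof.
move=> gfin mg.
have -> : (fun x => lne (g x)) =
    (fun x => if (g x <= 0)%E then -oo%E else (ln (fine (g x)))%:E).
  apply/funext => x; case: ifPn => [/le0_lneNy//|]; rewrite -ltNge.
  by rewrite -{1 2}(fineK (gfin x)) lte_fin => /lne_EFin.
apply: measurable_fun_ifT => //.
- exact: measurable_fun_lee.
- apply/measurable_EFinP; apply: measurableT_comp; first exact: measurable_ln.
  exact: measurableT_comp.
Qed.

Variables (eta : probability (measurableTypeR R) R) (V : R -> \bar R).
Hypothesis etaV : log_concave_with eta V.
Hypothesis eta_sym : symmetric_measure eta.
Hypothesis eta_cont : essentially_continuous eta V.

Local Notation v := (fine \o V).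
Local Notation f := (density V).
Local Notation q := (tail_quantile eta).
Local Notation u := (slope_profile eta V).
Local Notation half := (@half_unit R).

Let VNy : forall x, (V x != -oo)%E. Proof. by have [[]] := etaV. Qed.
Let Vconv : econvex_function V. Proof. by have [[]] := etaV. Qed.
Let Vsym : forall x, V (- x) = V x. Proof. exact: potential_even etaV eta_sym. Qed.
Let dopen : forall x : R, 0 <= x -> edom V x -> exists2 y : R, x < y & edom V y.
Proof. exact: edom_open etaV eta_sym eta_cont. Qed.
Let mhalf := measurable_half_unit (R := R).

Lemma measurable_derive_potential :
  measurable_fun setT (derive1 v : measurableTypeR R -> measurableTypeR R).
Proof. exact: (measurable_derive_fine VNy Vconv Vsym dopen). Qed.

Let mq : measurable_fun half (q : measurableTypeR R -> measurableTypeR R).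
Proof. exact: (measurable_tail_quantile etaV eta_sym). Qed.

(** The derivative of the potential at [q t] is [u t] and at [- q t] it is [- u t],
    except when [q t] is a kink; the kinks have mass 0 for [eta], so this concerns
    a null set of [t]. *)
Lemma moment_sym_law (nu : probability (measurableTypeR R) R) :
  is_moment_measure eta V nu -> sym_law nu u.
Proof.
move=> nuV A mA; rewrite nuV// /pushforward.
pose B : set (measurableTypeR R) := derive1 v @^-1` A.
have mB : measurable B.
  by rewrite /B -[X in measurable X]setTI; exact: measurable_derive_potential.
have mk : measurable (kink V : set (measurableTypeR R)).
  apply: countable_measurable => [t|]; first exact: measurable_set1.
  exact: countable_kink Vconv Vsym.
have eq_law := eta_sym_law etaV eta_sym.
have kink0 : eta (kink V) = 0%E.
  apply: (eta_null etaV) => //; apply: countable_lebesgue_measure0.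
  exact: countable_kink Vconv Vsym.
have mE : measurable (half `&` q @^-1` kink V : set (measurableTypeR R)) by exact: mq.
have E0 : mu (half `&` q @^-1` kink V) = 0%E.
  move: kink0; rewrite eq_law// => /eqP.
  by rewrite padde_eq0 ?measure_ge0// => /andP[/eqP].
have mu_ : measurable_fun half (u : measurableTypeR R -> measurableTypeR R).
  exact: (profile_slope_measurable (moment_profile etaV eta_sym eta_cont)).
have mqN : measurable_fun half ((fun t => - q t) : measurableTypeR R -> measurableTypeR R).
  exact: measurable_funN.
have muN : measurable_fun half ((fun t => - u t) : measurableTypeR R -> measurableTypeR R).
  exact: measurable_funN.
have qh t : half t -> [/\ 0 < q t & edom V (q t)].
  rewrite half_unitP => th; split; first exact: tail_quantile_gt0 etaV eta_sym _ th.
  exact: tail_quantile_edom etaV eta_sym _ th.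
have nj t : half t -> ~ kink V (q t) -> ~ slope_jump V (q t).
  by move=> /qh[q0 _] nk h; apply: nk; left; left; rewrite /= gtr0_norm.
rewrite -/B eq_law//; congr (_ + _)%E.
- apply: (measure_eq_off_null _ _ mE E0); [exact: mq|exact: mu_|].
  have dE t : half t -> ~ kink V (q t) -> derive1 v (q t) = u t.
    move=> ht nk; have [q0 dq] := qh t ht.
    by rewrite (derive_right_slope VNy Vconv Vsym dopen q0 dq)//; exact: nj.
  apply/seteqP; split => t [[ht At] nE]; have nk : ~ kink V (q t) by move=> k; apply: nE.
  + by split=> //; split=> //; move: At; rewrite /B /= dE.
  + by split=> //; split=> //; move: At; rewrite /B /= -dE.
- apply: (measure_eq_off_null _ _ mE E0); [exact: mqN|exact: muN|].
  have dE t : half t -> ~ kink V (q t) -> derive1 v (- q t) = - u t.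
    move=> ht nk; have [q0 dq] := qh t ht.
    by rewrite (derive_right_slopeN VNy Vconv Vsym dopen q0 dq)//; exact: nj.
  apply/seteqP; split => t [[ht At] nE]; have nk : ~ kink V (q t) by move=> k; apply: nE.
  + by split=> //; split=> //; move: At; rewrite /B /= dE.
  + by split=> //; split=> //; move: At; rewrite /B /= -dE.
Qed.

Local Open Scope ereal_scope.

(** The Radon-Nikodym derivative is only known almost everywhere for Lebesgue measure,
    which is enough as [eta] is absolutely continuous. *)
Lemma rel_entropy_potential : rel_entropy eta = \int[eta]_x (- V x).
Proof.
have dom : charge_of_finite_measure eta `<< mu.
  by apply/null_content_dominatesP => A mA A0; exact: (eta_null etaV).
pose g := Radon_Nikodym (charge_of_finite_measure eta) mu.
have gi : mu.-integrable setT g by exact: Radon_Nikodym_integrable.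
have mg : measurable_fun setT g by exact: measurable_int gi.
have mf : measurable_fun setT (fun x : measurableTypeR R => (f x)%:E).
  by apply/measurable_EFinP; exact: measurable_density etaV.
have gf : ae_eq mu setT g (fun x => (f x)%:E).
  apply: integral_ae_eq => // A _ mA.
  by rewrite -Radon_Nikodym_integral// -(eta_density etaV).
rewrite /rel_entropy; apply: ae_eq_integral => //.
- by apply: measurable_lne_fin => // x; exact: Radon_Nikodym_fin_num.
- by apply: measurableT_comp => //; exact: measurable_potential etaV.
- have : ae_eq eta setT g (fun x => (f x)%:E).
    have [N [mN N0 sub]] := gf.
    by exists N; split => //; exact: (eta_null etaV).
  apply: filterS => x /= h _; rewrite -/g h// -(densityE etaV).
  exact: expeRK.
Qed.

Lemma rel_entropy_profile :
  rel_entropy eta = 2%:E * \int[mu]_(t in half) (ln (density_profile eta V t))%:E.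
Proof.
rewrite rel_entropy_potential.
have mV : measurable_fun setT (fun x : measurableTypeR R => - V x).
  by apply: measurableT_comp => //; exact: measurable_potential etaV.
have P := moment_profile etaV eta_sym eta_cont.
have lnE t : half t -> - V (q t) = (ln (density_profile eta V t))%:E.
  rewrite half_unitP => th; have dq := tail_quantile_edom etaV eta_sym th.
  by rewrite /density_profile (density_gt0E etaV)// expRK (edomE VNy dq).
have lnNE t : half t -> - V (- q t)%R = (ln (density_profile eta V t))%:E.
  by move=> ht; rewrite Vsym lnE.
have eq_law := eta_sym_law etaV eta_sym.
have mqR : measurable_fun half q by exact: (measurable_tail_quantile etaV eta_sym).
have Iln := integrable_ln_profile P.
have E1 : \int[mu]_(t in half) (- V (q t)) =
          \int[mu]_(t in half) (ln (density_profile eta V t))%:E.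
  by apply: eq_integral => t; rewrite inE => /lnE.
have E2 : \int[mu]_(t in half) (- V (- q t)%R) =
          \int[mu]_(t in half) (ln (density_profile eta V t))%:E.
  by apply: eq_integral => t; rewrite inE => /lnNE.
have iV : eta.-integrable setT (fun x => - V x).
  apply/integrableP; split => //.
  rewrite (ge0_integral_sym_law mqR eq_law)//; last exact: measurableT_comp.
  have /integrableP[_ ln_lty] := Iln.
  have -> : \int[mu]_(t in half) `|- V (q t)| =
            \int[mu]_(t in half) `|(ln (density_profile eta V t))%:E|.
    by apply: eq_integral => t; rewrite inE => /lnE ->.
  have -> : \int[mu]_(t in half) `|- V (- q t)%R| =
            \int[mu]_(t in half) `|(ln (density_profile eta V t))%:E|.
    by apply: eq_integral => t; rewrite inE => /lnNE ->.
  exact: lte_add_pinfty.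
have [_ _ ->] := integral_sym_law mqR eq_law mV iV.
by rewrite E1 E2 mule_natl mule2n.
Qed.

End Transfer.

Theorem ET1s_4 (R : realType) : ET1s (4 : R).
Proof.
move=> eta1 eta2 nu1 nu2 V1 V2 lc1 lc2 s1 s2 c1 c2 m1 m2.
have P1 := moment_profile lc1 s1 c1; have P2 := moment_profile lc2 s2 c2.
rewrite (rel_entropy_profile lc1 s1 c1) (rel_entropy_profile lc2 s2 c2).
apply: le_trans (profile_inequality P1 P2) _.
rewrite leeD2l//; apply: le_transport_cost.
- exact: profile_slope_measurable P1.
- exact: profile_slope_measurable P2.
- exact: moment_sym_law.
- exact: moment_sym_law.
- by have [_ u0 _ _] := P1; move=> t; rewrite half_unitP; exact: u0.
- by have [_ u0 _ _] := P2; move=> t; rewrite half_unitP; exact: u0.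
- exact: integral_profile_slope_lty P1.
- exact: integral_profile_slope_lty P2.
Qed.

(** * Measures with a plateau and exponential tails *)
Section ExpTail.
Context {R : realType}.
Notation mu := (@lebesgue_measure R).

Lemma integral_expR_ray (m c : R) : 0 < m ->
  (\int[mu]_(x in `[c, +oo[) (m * expR (- m * (x - c)))%:E = 1)%E.
Proof.
move=> m0.
have dF (x : R) : is_derive x (1 : R) (fun x : R => - expR (- m * (x - c))) (m * expR (- m * (x - c))).
  by apply: is_derive_eq; rewrite subr0 /GRing.scale/=; ring.
have cF : continuous (fun x : R => - expR (- m * (x - c))).
  by move=> x; apply: differentiable_continuous; apply/derivable1_diffP; have [] := dF x.
have cf : continuous (fun x : R => m * expR (- m * (x - c))).
  by move=> x; apply: differentiable_continuous; apply/derivable1_diffP; exact: ex_derive.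
rewrite (@ge0_continuous_FTC2y _ _ (fun x => - expR (- m * (x - c))) c 0).
- by rewrite subrr mulr0 expR0 EFinN oppeK add0e.
- by move=> x _; rewrite mulr_ge0 ?expR_ge0 ?ltW.
- exact: continuous_subspaceT.
- rewrite -oppr0; apply: cvgN.
  have -> : (fun x => expR (- m * (x - c))) = (fun z => expR (- z)) \o (fun x => m * (x - c)).
    by apply/funext => x; rewrite /= mulNr.
  apply: (@cvg_comp _ _ _ _ _ _ (pinfty_nbhs R)); last exact: cvgr_expR.
  apply/cvgryPge => A; near=> x.
  rewrite -ler_pdivrMl// lerBrDr.
  by near: x; apply: nbhs_pinfty_ge; rewrite num_real.
- by move=> x _; have [] := dF x.
- by apply: cvg_at_right_filter; exact: cF.
- by move=> x _; rewrite derive1E; apply: derive_val.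
Unshelve. all: by end_near. Qed.

Lemma density_probability (g : measurableTypeR R -> R) :
  measurable_fun setT g -> (forall x, 0 <= g x) ->
  (\int[mu]_x (g x)%:E = 1)%E ->
  exists P : probability (measurableTypeR R) R,
    forall A, measurable A -> P A = (\int[mu]_(x in A) (g x)%:E)%E.
Proof.
move=> mg g0 g1.
pose p (A : set (measurableTypeR R)) := (\int[mu]_(x in A) (g x)%:E)%E.
have p0 : p set0 = 0%E by rewrite /p integral_set0.
have pge0 A : (0 <= p A)%E by apply: integral_ge0 => x _; rewrite lee_fin.
have psa : semi_sigma_additive p.
  move=> /= F mF tF mUF; rewrite /p; apply: cvg_toP.
    apply: ereal_nondecreasing_is_cvgn => m n mn.
    apply: lee_sum_nneg_natr => // k _ _; apply: integral_ge0 => /= x Fkx.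
    by rewrite lee_fin.
  rewrite ge0_integral_bigcup//=.
  - by apply/measurable_EFinP; exact: measurable_funTS.
  - by move=> x _; rewrite lee_fin.
pose pM : {measure set (measurableTypeR R) -> \bar R} :=
  HB.pack p (isMeasure.Build _ _ _ p p0 pge0 psa).
have pT : pM setT = 1%E by [].
pose pP : probability (measurableTypeR R) R :=
  HB.pack p (Measure.on pM) (Measure_isProbability.Build _ _ _ pM pT).
by exists pP.
Qed.

Lemma pushforward_probability (P : probability (measurableTypeR R) R)
    (g : measurableTypeR R -> measurableTypeR R) : measurable_fun setT g ->
  exists Q : probability (measurableTypeR R) R,
    forall A, measurable A -> Q A = pushforward P g A.
Proof.
move=> mg.
pose X : {mfun measurableTypeR R >-> measurableTypeR R} :=
  HB.pack g (isMeasurableFun.Build _ _ _ _ _ mg).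
by exists [the probability _ _ of distribution P X].
Qed.

Lemma integral_even_reflect (g : R -> R) (A : set (measurableTypeR R)) :
  measurable_fun setT (g : measurableTypeR R -> R) -> (forall x, 0 <= g x) ->
  (forall x, g (- x) = g x) -> measurable A ->
  (\int[mu]_(x in A) (g x)%:E = \int[mu]_(x in [set (- x)%R | x in A]) (g x)%:E)%E.
Proof.
move=> mg g0 gN mA.
have mopp : measurable_fun setT (-%R : measurableTypeR R -> measurableTypeR R).
  exact: oppr_measurable.
have -> : [set - x | x in A] = (-%R : measurableTypeR R -> measurableTypeR R) @^-1` A.
  apply/seteqP; split => [_ [x Ax <-]|x Ax]; first by rewrite /= opprK.
  by exists (- x) => //; rewrite opprK.
have -> : (\int[mu]_(x in A) (g x)%:E = \int[pushforward mu (-%R : measurableTypeR R -> measurableTypeR R)]_(x in A) (g x)%:E)%E.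
  have [Q QE] := pushforward_measure mu mopp.
  rewrite -QE; apply: eq_measure_integral => B mB _.
  by rewrite QE lebesgue_measureN.
rewrite ge0_integral_pushforward//.
- by apply: eq_integral => x _ /=; rewrite gN.
- by apply/measurable_EFinP; exact: measurable_funTS.
- by move=> x _; rewrite lee_fin.
Qed.

End ExpTail.

Section Plateau.
Context {R : realType}.
Notation mu := (@lebesgue_measure R).

(** Density 1/2 on [- (1 - d), 1 - d], with exponential tails of scale [d]: each tail
    has mass [d / 2], so the total mass is 1 whatever [d] is. *)
Definition plateau (d x : R) : R := ln 2 + Num.max 0 ((`|x| - (1 - d)) / d).
Definition plateau_potential (d x : R) : \bar R := (plateau d x)%:E.

Variable d : R.
Hypotheses (d0 : 0 < d) (d1 : d <= 1).

Local Notation W := (plateau d).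
Local Notation V := (plateau_potential d).
Local Notation b := (1 - d).
Local Notation g := (fun x => expR (- W x)).

Let b0 : 0 <= b. Proof. by rewrite subr_ge0. Qed.

Lemma plateau_even x : W (- x) = W x.
Proof. by rewrite /plateau normrN. Qed.

Lemma plateau_flat x : `|x| <= b -> W x = ln 2.
Proof.
move=> xb; rewrite /plateau (max_idPl _) ?addr0//.
by rewrite ler_pdivrMr// mul0r subr_le0.
Qed.

Lemma plateau_tail x : b <= `|x| -> W x = ln 2 + (`|x| - b) / d.
Proof.
move=> xb; rewrite /plateau (max_idPr _)//.
by rewrite divr_ge0 ?subr_ge0// ltW.
Qed.

(** This controls both the continuity of the potential and its slopes. *)
Lemma plateau_lip x y : W x - W y <= `|x - y| / d.
Proof.
have h : (`|x| - b) / d <= (`|y| - b) / d + `|x - y| / d.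
  rewrite -mulrDl ler_pM2r ?invr_gt0//.
  have := ler_normB x (x - y); have -> : x - (x - y) = y by ring.
  have := lerB_normD y (x - y).
  have := ler_normD y (x - y); have -> : y + (x - y) = x by ring.
  lra.
have p : 0 <= `|x - y| / d by rewrite divr_ge0// ltW.
have q : 0 <= Num.max 0 ((`|y| - b) / d) by rewrite le_max lexx.
have r : (`|y| - b) / d <= Num.max 0 ((`|y| - b) / d) by rewrite le_max lexx orbT.
have : Num.max 0 ((`|x| - b) / d) <= Num.max 0 ((`|y| - b) / d) + `|x - y| / d.
  by rewrite ge_max; apply/andP; split; lra.
rewrite /plateau; lra.
Qed.

Lemma plateau_continuous : continuous W.
Proof.
move=> x; apply/cvgrPdist_le => e e0; apply/nbhs_ballP.
exists (e * d) => /=; first exact: mulr_gt0.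
move=> y; rewrite /ball/= -ltr_pdivrMr// => xy.
rewrite ler_norml; have h1 := plateau_lip x y; have h2 := plateau_lip y x.
by rewrite (distrC y x) in h2; apply/andP; split; lra.
Qed.

Lemma plateau_convex_lsc : convex_lsc V.
Proof.
split=> //.
- move=> x y t /andP[t0 t1].
  rewrite /plateau_potential -!EFinM -EFinD lee_fin.
  have s0 : 0 <= 1 - t by rewrite subr_ge0.
  have tri : `|t * x + (1 - t) * y| <= t * `|x| + (1 - t) * `|y|.
    by rewrite (le_trans (ler_normD _ _))// !normrM (ger0_norm t0) (ger0_norm s0).
  have px : 0 <= Num.max 0 ((`|x| - b) / d) by rewrite le_max lexx.
  have py : 0 <= Num.max 0 ((`|y| - b) / d) by rewrite le_max lexx.
  have qx : (`|x| - b) / d <= Num.max 0 ((`|x| - b) / d) by rewrite le_max lexx orbT.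
  have qy : (`|y| - b) / d <= Num.max 0 ((`|y| - b) / d) by rewrite le_max lexx orbT.
  have h1 : (`|t * x + (1 - t) * y| - b) / d <=
     t * ((`|x| - b) / d) + (1 - t) * ((`|y| - b) / d).
    have -> : t * ((`|x| - b) / d) + (1 - t) * ((`|y| - b) / d) =
      (t * `|x| + (1 - t) * `|y| - b) / d by field; rewrite gt_eqF.
    by rewrite ler_pM2r ?invr_gt0// lerD2r.
  have : Num.max 0 ((`|t * x + (1 - t) * y| - b) / d) <=
    t * Num.max 0 ((`|x| - b) / d) + (1 - t) * Num.max 0 ((`|y| - b) / d).
    rewrite ge_max addr_ge0 ?mulr_ge0//=; apply: (le_trans h1).
    by apply: lerD; exact: ler_wpM2l.
  rewrite /plateau; lra.
- move=> x a; rewrite /plateau_potential lte_fin => ax.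
  have aW : nbhs (W x) [set z : R | a < z] by apply: open_nbhs_nbhs; split => //; exact: open_gt.
  by exists (W @^-1` [set z | a < z]); [exact: plateau_continuous aW|move=> y /=; rewrite lte_fin].
Qed.

Lemma measurable_plateau_density : measurable_fun setT (g : measurableTypeR R -> R).
Proof.
apply: continuous_measurable_fun => x.
apply: continuous_comp; last exact: continuous_expR.
by apply: (@continuousN _ R^o); exact: plateau_continuous.
Qed.

Let mg (A : set (measurableTypeR R)) : measurable_fun A (fun x : measurableTypeR R => (g x)%:E).
Proof. by apply/measurable_EFinP; apply: measurable_funS measurable_plateau_density. Qed.

Local Open Scope ereal_scope.

(** On the positive half-line the plateau has mass [(1 - d) / 2] and the tail
    [d / 2]. *)
Lemma plateau_mass : \int[mu]_x (g x)%:E = 1.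
Proof.
have ray : \int[mu]_(x in `[0%R, +oo[) (g x)%:E = (2^-1)%:E.
  have -> : `[0%R, +oo[%classic = `[0%R, b%R[ `|` `[b%R, +oo[.
    by rewrite -itv_bndbnd_setU// bnd_simp.
  rewrite ge0_integral_setU//=.
  - have -> : \int[mu]_(x in `[0%R, b%R[) (g x)%:E = (2^-1 * b)%:E.
      have -> : \int[mu]_(x in `[0%R, b%R[) (g x)%:E = \int[mu]_(x in `[0%R, b%R[) (2^-1)%:E.
        apply: eq_integral => x; rewrite inE /= in_itv/= => /andP[x0 xb].
        by rewrite plateau_flat ?expRN ?lnK ?posrE// ger0_norm// ltW.
      rewrite integral_cst//= lebesgue_measure_itv/= lte_fin.
      case: ltP => [_|bb]; first by rewrite sube0 EFinM.
      have -> : b = 0%R by apply/eqP; rewrite eq_le bb b0.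
      by rewrite mule0 mulr0.
    have -> : \int[mu]_(x in `[b%R, +oo[) (g x)%:E =
        (2^-1 * d)%:E * \int[mu]_(x in `[b%R, +oo[) (d^-1 * expR (- d^-1 * (x - b)))%:E.
      rewrite -ge0_integralZl_EFin//; last 3 first.
      - by move=> x _; rewrite lee_fin mulr_ge0 ?expR_ge0// invr_ge0 ltW.
      - apply/measurable_EFinP; apply: measurable_funM => //.
        apply: measurableT_comp => //; apply: measurable_funM => //.
        exact: measurable_funB.
      - by rewrite mulr_ge0// ltW.
      apply: eq_integral => x; rewrite inE /= in_itv/= andbT => bx.
      have x0 : (0 <= x)%R by exact: le_trans bx.
      rewrite plateau_tail ger0_norm// opprD expRD expRN lnK ?posrE// -EFinM; congr EFin.
      have -> : (- ((x - b) / d) = - d^-1 * (x - b))%R by ring.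
      by field; rewrite gt_eqF.
    by rewrite integral_expR_ray ?invr_gt0// mule1 -EFinD; congr EFin; ring.
  - apply/disj_setPS => x [] /=; rewrite !in_itv/= andbT => /andP[_ xb] /(lt_le_trans xb).
    by rewrite ltxx.
rewrite (@ge0_symfun_integralT _ g).
- rewrite -set_itvcy ray -EFinM; congr EFin; rewrite divff//.
- by move=> x; rewrite expR_ge0.
- move=> x; apply: continuous_comp; last exact: continuous_expR.
  by apply: (@continuousN _ R^o); exact: plateau_continuous.
- by move=> x; rewrite /= plateau_even.
Qed.

Lemma plateau_measure : exists2 eta : probability (measurableTypeR R) R,
  log_concave_with eta V & symmetric_measure eta /\ essentially_continuous eta V.
Proof.
have [eta etaE] := density_probability measurable_plateau_density
  (fun x => expR_ge0 (- W x)) plateau_mass.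
have lc : log_concave_with eta V by split; [exact: plateau_convex_lsc|exact: etaE].
have sy : symmetric_measure eta.
  move=> A mA; rewrite !etaE//; last first.
    have -> : [set (- x)%R | x in A] = (-%R : measurableTypeR R -> measurableTypeR R) @^-1` A.
      apply/seteqP; split => [_ [x Ax <-]|x Ax]; first by rewrite /= opprK.
      by exists (- x)%R => //; rewrite opprK.
    by rewrite -[X in measurable X]setTI; exact: oppr_measurable.
  apply: integral_even_reflect => //.
  - exact: measurable_plateau_density.
  - by move=> x; rewrite plateau_even.
exists eta => //; split => // x [_ +].
suff -> : measure_support eta = setT by rewrite interiorT => /(_ Logic.I).
apply/seteqP; split => // y _ U oU Uy.
have /nbhs_ballP[r /= r0 rU] : nbhs y U by exact: open_nbhs_nbhs.
have rr : (y - r <= y + r)%R by lra.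
pose M := (`|y| + r)%R.
have low (z : R) : (y - r < z < y + r)%R -> (density V M <= density V z)%R.
  move=> /andP[z1 z2]; apply: (density_even_le lc sy).
  have M0 : (0 <= M)%R by rewrite addr_ge0// ltW.
  rewrite (ger0_norm M0) ler_norml /M.
  have h1 := ler_norm y; have h2 := ler_norm (- y)%R; rewrite normrN in h2.
  by apply/andP; split; lra.
apply: (@lt_le_trans _ _ (eta `](y - r)%R, (y + r)%R[%classic)).
  apply: lt_le_trans (eta_itv_ge lc rr low (density_ge0 V M)).
  rewrite lte_fin mulr_gt0//; last by lra.
  by apply/(density_gt0 lc); rewrite /edom/= ltry.
apply: le_measure; rewrite ?inE//; first exact: open_measurable.
move=> z /=; rewrite in_itv/= => /andP[z1 z2]; apply: rU; rewrite /ball/=.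
by rewrite ltr_norml; apply/andP; split; lra.
Qed.

End Plateau.

Section PlateauProfile.
Context {R : realType}.
Notation mu := (@lebesgue_measure R).
Local Notation half := (@half_unit R).
Variable d : R.
Hypotheses (d0 : 0 < d) (d1 : d <= 1).
Local Notation W := (plateau d).
Local Notation V := (plateau_potential d).
Variable eta : probability (measurableTypeR R) R.
Hypotheses (etaV : log_concave_with eta V) (eta_sym : symmetric_measure eta)
  (eta_cont : essentially_continuous eta V).

Local Notation I := (density_profile eta V).
Local Notation u := (slope_profile eta V).
Local Notation q := (tail_quantile eta).

Let VNy : forall x, (V x != -oo)%E. Proof. by have [[]] := etaV. Qed.
Let Vconv : econvex_function V. Proof. by have [[]] := etaV. Qed.
Let Vsym : forall x, V (- x) = V x. Proof. exact: potential_even etaV eta_sym. Qed.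
Let P : profile I u. Proof. exact: moment_profile. Qed.
Let dom x : edom V x. Proof. by rewrite /edom/= ltry. Qed.

Lemma plateau_density_profile_le (t : R) : I t <= 2^-1.
Proof.
rewrite /density_profile (density_gt0E etaV (dom _)) /=.
rewrite -[leRHS](@lnK R) ?posrE ?invr_gt0// ler_expR lnV ?posrE// lerN2 /plateau.
by rewrite lerDl le_max lexx.
Qed.

Lemma plateau_slope_le (t : R) : 0 < t < 2^-1 -> u t <= d^-1.
Proof.
move=> th; have [y qy dy] := tail_quantile_right etaV eta_sym eta_cont th.
have q0 := tail_quantile_gt0 etaV eta_sym th.
have h1 := right_slope_le VNy Vconv Vsym (ltW q0) qy dy.
have h2 := plateau_lip d0 y (q t).
have yq : 0 < y - q t by rewrite subr_gt0.
rewrite -(@ler_pM2r _ (y - q t))//; apply: (le_trans h1); apply: (le_trans h2).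
by rewrite gtr0_norm// mulrC.
Qed.

(** On the tail the slope is at least [1 / d], and [u t * t <= I t]. *)
Lemma plateau_density_profile_ge (t : R) : 0 < t < 2^-1 -> I t = 2^-1 \/ t / d <= I t.
Proof.
move=> th; have q0 := tail_quantile_gt0 etaV eta_sym th.
have [qb|bq] := leP (q t) (1 - d).
  left; rewrite /density_profile (density_gt0E etaV (dom _)) /= plateau_flat//.
    by rewrite expRN lnK ?posrE.
  by rewrite gtr0_norm.
right; have [Iu u0 I0 v] := P; have /andP[t0 t2] := th.
have Ige0 s : 0 < s < 2^-1 -> 0 <= I s by move=> /I0/ltW.
apply: le_trans (mul_supergradient_le Iu u0 Ige0 th).
rewrite mulrC; apply: ler_wpM2r; first exact: ltW.
have b0 : 0 <= 1 - d by rewrite subr_ge0.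
have bq' : 0 < q t - (1 - d) by rewrite subr_gt0.
have := left_le_right_slope VNy Vconv (tail_quantile_right etaV eta_sym eta_cont th) bq (dom _).
have -> : (fine \o V) (1 - d) = ln 2 by rewrite /= (plateau_flat d0)// ger0_norm.
have -> : (fine \o V) (q t) = ln 2 + (`|q t| - (1 - d)) / d.
  by rewrite /= (plateau_tail d0)// gtr0_norm// ltW.
rewrite gtr0_norm// => h.
rewrite -(@ler_pM2r _ (q t - (1 - d)))//; apply: le_trans h.
by rewrite mulrC; lra.
Qed.

Local Open Scope ereal_scope.

(** The profile is at least [t / d] for [t < d / 2] and [1 / 2] beyond, and the integral
    of the logarithm of this bound is explicit. *)
Lemma plateau_entropy_ge : (- (ln 2 + d))%:E <= rel_entropy eta.
Proof.
rewrite (rel_entropy_profile etaV eta_sym eta_cont).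
have [Iu u0 I0 v] := P.
have mI := profile_measurable P.
pose A : set (measurableTypeR R) := `]0%R, (d / 2)%R[%classic.
pose B : set (measurableTypeR R) := `[(d / 2)%R, (2^-1)%R[%classic.
have dd : (0 < d / 2)%R by rewrite divr_gt0.
have d2 : (d / 2 <= 2^-1)%R by rewrite -[leRHS]mul1r ler_pM2r ?invr_gt0.
have hAB : half = A `|` B.
  by rewrite /half_unit /A /B -itv_bndbnd_setU // bnd_simp ?(ltW dd) ?d2.
have mlnI : measurable_fun half (fun t => (- ln (I t))%:E).
  apply/measurable_EFinP; apply: measurable_funN.
  by apply: measurableT_comp => //; exact: measurable_ln.
have lnI t : half t -> (ln 2 <= - ln (I t))%R.
  rewrite half_unitP => th; rewrite -lnV ?posrE ?I0// ler_ln ?posrE ?invr_gt0 ?I0//.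
  rewrite -[leLHS]invrK lef_pV2 ?posrE ?invr_gt0 ?I0//.
  exact: plateau_density_profile_le.
have ln2 : (0 <= ln 2 :> R)%R by rewrite ln_ge0// ler1n.
have lnI0 t : half t -> 0 <= (- ln (I t))%:E.
  by move=> /lnI h; rewrite lee_fin (le_trans ln2).
have mA : measurable A by exact: measurable_itv.
have mB : measurable B by exact: measurable_itv.
have AH : A `<=` half by rewrite hAB; exact: subsetUl.
have BH : B `<=` half by rewrite hAB; exact: subsetUr.
have lnd : (0 <= - ln d)%R by rewrite oppr_ge0 ln_le0.
have IA : \int[mu]_(t in A) (- ln (I t))%:E <= (d / 2 + d / 2 * ln 2)%:E.
  have lenA : mu A = (d / 2)%:E by rewrite /A lebesgue_measure_itv/= lte_fin dd sube0.
  (* - ln d is added rather than ln d subtracted, so that all integrands are nonnegative *)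
  have : \int[mu]_(t in A) ((- ln (I t))%:E + (- ln d)%:E) <= \int[mu]_(t in A) (- ln t)%:E.
    apply: ge0_le_integral => //.
    - by move=> t /AH /lnI0 h; rewrite adde_ge0// lee_fin.
    - by apply: emeasurable_funD => //; exact: measurable_funS (measurable_half_unit (R := R)) _ mlnI.
    - apply/measurable_EFinP; apply: measurable_funN.
      by apply: measurable_funS (@measurable_ln R).
    - move=> t At; have := AH t At; rewrite half_unitP => th; have /andP[t0 t2] := th.
      move: At; rewrite /A/= in_itv/= => /andP[_ td].
      have tdI : (t / d <= I t)%R.
        have [->|//] := plateau_density_profile_ge th.
        by rewrite ler_pdivrMr//; lra.
      rewrite -EFinD lee_fin.
      have : (ln (t / d) <= ln (I t))%R by rewrite ler_ln ?posrE ?I0// divr_gt0.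
      by rewrite ln_div ?posrE//; lra.
  rewrite ge0_integralD//; last 2 first.
  - by move=> t /AH /lnI0.
  - exact: measurable_funS (measurable_half_unit (R := R)) _ mlnI.
  rewrite integral_cst//= lenA integral_ln; last by apply/andP; split; lra.
  rewrite ln_div ?posrE//.
  have : 0 <= \int[mu]_(t in A) (- ln (I t))%:E by apply: integral_ge0 => t /AH /lnI0.
  case: (\int[mu]_(t in A) _) => [r| |] //.
  by rewrite -EFinM -EFinD !lee_fin => _ h; lra.
have IB : \int[mu]_(t in B) (- ln (I t))%:E <= ((2^-1 - d / 2) * ln 2)%:E.
  have lenB : mu B = (2^-1 - d / 2)%:E.
    rewrite /B lebesgue_measure_itv/= lte_fin; case: ltP => [_|h]; first by rewrite EFinB.
    by congr EFin; lra.
  have -> : ((2^-1 - d / 2) * ln 2)%:E = \int[mu]_(t in B) (ln 2)%:E.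
    by rewrite integral_cst//= lenB -EFinM mulrC.
  apply: ge0_le_integral => //.
  - by move=> t /BH /lnI0.
  - exact: measurable_funS (measurable_half_unit (R := R)) _ mlnI.
  - move=> t Bt; have := BH t Bt; rewrite half_unitP => th.
    have Ih : (2^-1 <= I t)%R.
      have [->//|] := plateau_density_profile_ge th.
      apply: le_trans; move: Bt; rewrite /B/= in_itv/= => /andP[h _].
      by rewrite ler_pdivlMr//; lra.
    rewrite lee_fin -lnV ?posrE ?I0// ler_ln ?posrE ?invr_gt0 ?I0//.
    by rewrite -[leRHS]invrK lef_pV2 ?posrE ?invr_gt0 ?I0.
have E : \int[mu]_(t in half) (ln (I t))%:E = - \int[mu]_(t in half) (- ln (I t))%:E.
  rewrite -integral_ge0N//; apply: eq_integral => t _.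
  by rewrite -EFinN opprK.
have S : \int[mu]_(t in half) (- ln (I t))%:E <= ((ln 2 + d) / 2)%:E.
  have AB : [disjoint A & B].
    apply/disj_setPS => t [] /=; rewrite /A /B /= !in_itv/= => /andP[_ h1] /andP[h2 _].
    by move: (lt_le_trans h1 h2); rewrite ltxx.
  rewrite hAB in lnI0 mlnI *; rewrite ge0_integral_setU//.
  by apply: (le_trans (leeD IA IB)); rewrite -EFinD lee_fin; lra.
rewrite E.
have : 0 <= \int[mu]_(t in half) (- ln (I t))%:E by exact: integral_ge0.
move: S; case: (\int[mu]_(t in half) _) => [r| |] //.
by rewrite -EFinN -EFinM !lee_fin => h _; lra.
Qed.

End PlateauProfile.

(** * Optimality of the constant *)
Section Optimality.
Context {R : realType}.
Notation mu := (@lebesgue_measure R).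
Local Notation half := (@half_unit R).
Local Open Scope ereal_scope.

(** The dual optimizer for the Laplace moment measure, which is carried by -1 and 1:
    it vanishes there, and its conjugate is the absolute value. *)
Definition unit_indicator (x : R) : \bar R := if (`|x| <= 1)%R then 0 else +oo.

Lemma unit_indicator_proper : proper_convex_lsc unit_indicator.
Proof.
split; last by exists 0%R; rewrite /unit_indicator normr0 ler01.
have ge0 x : 0 <= unit_indicator x by rewrite /unit_indicator; case: ifP.
split.
- by move=> x; rewrite -ltNye (lt_le_trans _ (ge0 x)).
- move=> x y t /andP[t0 t1].
  have s0 : (0 <= 1 - t)%R by rewrite subr_ge0.
  rewrite {1}/unit_indicator; case: ifPn => [_|].
    by rewrite adde_ge0// mule_ge0// ?ge0 ?lee_fin.
  rewrite -ltNge => h.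
  have : (1 < t * `|x| + (1 - t) * `|y|)%R.
    by rewrite (lt_le_trans h)// (le_trans (ler_normD _ _))// !normrM (ger0_norm t0) (ger0_norm s0).
  move=> {}h; rewrite leye_eq.
  have [t00|tn0] := eqVneq t 0%R.
    move: h; rewrite t00 mul0r add0r subr0 !mul1r mul0e add0e mul1e => h.
    by rewrite /unit_indicator leNgt h.
  have [t11|tn1] := eqVneq t 1%R.
    move: h; rewrite t11 subrr mul0r addr0 !mul1r mul0e adde0 mul1e => h.
    by rewrite /unit_indicator leNgt h.
  have tp : (0 < t)%R by rewrite lt_neqAle eq_sym tn0.
  have sp : (0 < 1 - t)%R by rewrite subr_gt0 lt_neqAle tn1.
  have [x1|x1] := leP `|x|%R 1%R; last first.
    by rewrite {1}/unit_indicator leNgt x1/= gt0_muley ?lte_fin// addye// gt_eqF// (lt_le_trans ltNy0)// mule_ge0// lee_fin.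
  have [y1|y1] := leP `|y|%R 1%R; first by exfalso; nra.
  by rewrite {2}/unit_indicator leNgt y1/= gt0_muley ?lte_fin// addey// gt_eqF// (lt_le_trans ltNy0)// mule_ge0// lee_fin.
- move=> x a; rewrite {1}/unit_indicator; case: ifPn => [_ a0|].
    by exists setT; [exact: filterT|move=> y _; exact: lt_le_trans (ge0 y)].
  rewrite -ltNge => x1 _.
  have o : open [set y : R | (1 < `|y|)%R].
    apply: (@open_comp _ _ (fun y : R => `|y|%R) [set z | (1 < z)%R]).
      by move=> y _; exact: norm_continuous.
    exact: open_gt.
  exists [set y : R | (1 < `|y|)%R]; first by apply: open_nbhs_nbhs; split.
  by move=> y /= y1; rewrite /unit_indicator leNgt y1 ltry.
Qed.

Lemma legendre_unit_indicator y : 0 <= legendre unit_indicator y <= `|y|%:E.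
Proof.
apply/andP; split.
  apply: ereal_sup_ubound; exists 0%R => //.
  by rewrite /unit_indicator normr0 ler01 mul0r sube0.
apply: ge_ereal_sup => _ [x _ <-]; rewrite /unit_indicator.
case: ifPn => [x1|_]; last by rewrite leNye.
rewrite sube0 lee_fin (le_trans (ler_norm _))// normrM.
by rewrite -[leRHS]mul1r ler_wpM2r.
Qed.

(** Take the Laplace measure and the plateau of parameter [d < ln (c / 4)].  Testing
    with [unit_indicator], the cost is at most the first absolute moment of the second
    moment measure, which is twice the integral of the slope of a profile bounded
    by 1/2.
    The inequality would give [- 2 * ln 2 - 1 - d <= - ln c - 2 + 1]. *)
Lemma ET1s_optimal (c : R) : (4 < c)%R -> ~ ET1s c.
Proof.
move=> c4 ET.
have c0 : (0 < c)%R by lra.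
pose L := ln (c / 4)%R.
have L0 : (0 < L)%R by rewrite ln_gt0// ltr_pdivlMr// mul1r.
pose d := (Num.min 1 (L / 2))%R.
have d0 : (0 < d)%R by rewrite lt_min ltr01 divr_gt0.
have d1 : (d <= 1)%R by rewrite ge_min lexx.
have dL : (d < L)%R by rewrite (@le_lt_trans _ _ (L / 2)%R) ?ge_min ?lexx ?orbT//; lra.
have [eta1 lc1 [s1 e1]] := plateau_measure (ltr01 : 0 < 1 :> R)%R (lexx 1%R).
have [eta2 lc2 [s2 e2]] := plateau_measure d0 d1.
have [nu1 m1] := pushforward_probability eta1 (measurable_derive_potential lc1 s1 e1).
have [nu2 m2] := pushforward_probability eta2 (measurable_derive_potential lc2 s2 e2).
have law1 := moment_sym_law lc1 s1 e1 m1.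
have law2 := moment_sym_law lc2 s2 e2 m2.
have := ET _ _ _ _ _ _ lc1 lc2 s1 s2 e1 e2 m1 m2.
have P1 := moment_profile lc1 s1 e1; have P2 := moment_profile lc2 s2 e2.
have mu1 := profile_slope_measurable P1; have mu2 := profile_slope_measurable P2.
have [_ u10 _ _] := P1; have [_ u20 _ _] := P2.
have T1 : transport_cost nu1 nu2 <= 1.
  apply: ge_ereal_inf; exists (\int[nu1]_x unit_indicator x + \int[nu2]_y legendre unit_indicator y).
    by exists unit_indicator => //; exact: unit_indicator_proper.
  have [[iNy _ ilsc] _] := unit_indicator_proper.
  have mi : measurable_fun setT (unit_indicator : measurableTypeR R -> \bar R).
    exact: lower_semicontinuous_measurable.
  have ml : measurable_fun setT (legendre unit_indicator : measurableTypeR R -> \bar R).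
    by apply: lower_semicontinuous_measurable; exact: legendre_lsc.
  have u1_le t : half t -> (`|slope_profile eta1 (plateau_potential 1) t| <= 1)%R.
    rewrite half_unitP => th; rewrite ger0_norm ?u10//.
    by have := plateau_slope_le (ltr01 : 0 < 1 :> R)%R lc1 s1 e1 th; rewrite invr1.
  rewrite (ge0_integral_sym_law mu1 law1)//; last first.
    by move=> x; rewrite /unit_indicator; case: ifP.
  rewrite integral0_eq; last by move=> t /u1_le h; rewrite /unit_indicator h.
  rewrite add0e integral0_eq ?add0e; last first.
    by move=> t /u1_le h; rewrite /unit_indicator normrN h.
  have mabs : measurable_fun setT (fun y : measurableTypeR R => (`|y|%R)%:E).
    exact/measurable_EFinP.
  apply: (@le_trans _ _ (\int[nu2]_y (`|y|%R)%:E)).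
    by apply: ge0_le_integral => // y _; have /andP[] := legendre_unit_indicator y.
  rewrite (ge0_integral_sym_law mu2 law2)//.
  have E2 : \int[mu]_(t in half) (`|slope_profile eta2 (plateau_potential d) t|%R)%:E <= (2^-1)%:E.
    rewrite (_ : \int[mu]_(t in half) _ =
      \int[mu]_(t in half) (slope_profile eta2 (plateau_potential d) t)%:E); last first.
      by apply: eq_integral => t; rewrite inE half_unitP => th; rewrite ger0_norm// u20.
    by apply: (integral_profile_slope P2) => t _; exact: plateau_density_profile_le.
  under [X in _ + X]eq_integral do rewrite normrN.
  by apply: (le_trans (leeD E2 E2)); rewrite -EFinD lee_fin; lra.
have H1 := plateau_entropy_ge (ltr01 : 0 < 1 :> R)%R (lexx 1%R) lc1 s1 e1.
have H2 := plateau_entropy_ge d0 d1 lc2 s2 e2.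
move=> /(le_trans (leeD H1 H2)) H.
have {H} := le_trans H (leeD (lexx _) T1).
rewrite -!EFinD lee_fin.
have E1 : (expR (1 : R) ^+ 2 = expR 2)%R by rewrite -expRM_natl mulr1.
rewrite lnM ?posrE ?exprn_gt0 ?expR_gt0// E1 expRK.
have LE : L = (ln c - 2 * ln 2)%R.
  rewrite /L ln_div ?posrE//; congr (_ - _)%R.
  by rewrite (_ : 4 = 2 ^+ 2 :> R)%R ?lnXn// ?mulr_natl//; rewrite expr2; ring.
lra.
Qed.

End Optimality.

Theorem theorem3p3 (R : realType) :
  ET1s (4 : R) /\ (forall c : R, 4 < c -> ~ ET1s c).
Proof. by split; [exact: ET1s_4|exact: ET1s_optimal]. Qed.
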